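(* Let $0<\sigma_{\min}\le\sigma_{\max}<\infty$, $\mu\in\mathbb{R}$, $\sigma_i\in[\sigma_{\min},\sigma_{\max}]$ for all $i\in[n]$, $\delta\in(0,1)$, and let the number of signals be $m$ in the subset-of-signals problem, i.e. $|\{i\in[n]:\sigma_i\le1\}|\ge m$. Let $X_1,\dots,X_n$ be independent with $X_i\sim\mathcal{N}(\mu,\sigma_i^2)$, and let $\widehat\mu^{\mathrm{EB}}=\widehat\mu$ where $$(\widehat\mu,\widehat G)\in\operatorname*{arg\,max}_{\mu'\in\mathbb{R},\ \operatorname{supp}(G)\subseteq[\sigma_{\min},\sigma_{\max}]}\ \frac1n\sum_{i=1}^n\log f_{\mu',G}(X_i).$$ Then with probability at least $1-\delta$, $$|\widehat\mu^{\mathrm{EB}}-\mu|=\begin{cases}\widetilde O\Big(\Big(\dfrac{n}{m^4}\Big)^{1/2}\Big)&\text{if }\widetilde O(1)\ll m\le n^{1/4},\\[2mm] \widetilde O\Big(\Big(\dfrac{n}{m^4}\Big)^{1/6}\Big)&\text{if }n^{1/4}\le m\le n,\end{cases}$$ where $\widetilde O(\cdot)$ hides polylogarithmic factors in $\big(n,\frac{\sigma_{\max}}{\sigma_{\min}},\frac1\delta\big)$.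
   Context: For $\mu\in\mathbb{R}$ and a probability distribution $G$ on $(0,\infty)$, $f_{\mu,G}(x)=\mathbb{E}_{\sigma\sim G}\big[\frac1\sigma\varphi\big(\frac{x-\mu}{\sigma}\big)\big]$, where $\varphi$ is the standard normal density. In the maximization, $G$ ranges over all probability distributions supported on $[\sigma_{\min},\sigma_{\max}]$, and $(\widehat\mu,\widehat G)$ is a maximizer. $[n]=\{1,\dots,n\}$. The condition $\widetilde O(1)\ll m$ means that $m$ exceeds a sufficiently large polylogarithmic factor in $\big(n,\frac{\sigma_{\max}}{\sigma_{\min}},\frac1\delta\big)$.
   Formalization: The condition Õ(1)≪m is required in the second case (n^{1/4}≤m≤n) as well; without it that case fails, e.g. for n=16, m=2, σ_1=σ_2=1=σ_min, all other σ_i=σ_max=S large, and δ=c/S with small c. *)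

(* Defs.v *)
From HB Require Import structures.
From mathcomp Require Import all_boot all_order all_algebra.
From mathcomp Require Import all_classical all_reals all_analysis.

Set Implicit Arguments.
Unset Strict Implicit.
Unset Printing Implicit Defensive.

Import Order.TTheory GRing.Theory Num.Theory.
Import numFieldNormedType.Exports.

Local Open Scope classical_set_scope.
Local Open Scope ring_scope.

(* Every polynomial in ln n, ln r and ln (1 / delta) is bounded by some
   polylog C k n r delta when 1 <= n, 1 <= r and 0 < delta < 1; the summand 1
   keeps the factor positive when these logarithms are close to 0. *)
Definition polylog (R : realType) (C : R) (k n : nat) (r delta : R) : R :=
  C * (1 + ln n%:R + ln r + ln delta^-1) ^+ k.

(* Open neighbourhoods, so that G is only evaluated on measurable sets. *)
Definition msupport (R : realType) (G : probability (measurableTypeR R) R) :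
    set R :=
  [set x | forall U : set R, open_nbhs x U -> (0 < G U)%E].

Definition mixture_density (R : realType) (mu : R)
    (G : probability (measurableTypeR R) R) (x : R) : R :=
  fine ('E_G[(fun s : R => s^-1 * normal_pdf 0 1 ((x - mu) / s))%R])%E.

Definition avg_loglik (R : realType) (n : nat) (x : 'I_n -> R) (mu : R)
    (G : probability (measurableTypeR R) R) : R :=
  n%:R^-1 * \sum_(i < n) ln (mixture_density mu G (x i)).

Definition is_EB_maximizer (R : realType) (n : nat) (smin smax : R)
    (x : 'I_n -> R) (mu : R) (G : probability (measurableTypeR R) R) : Prop :=
  msupport G `<=` `[smin, smax] /\
  forall (mu' : R) (G' : probability (measurableTypeR R) R),
    msupport G' `<=` `[smin, smax] ->
    avg_loglik x mu' G' <= avg_loglik x mu G.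

Definition independent_RVs d (T : measurableType d) (R : realType)
    (P : probability T R) (n : nat) (X : 'I_n -> {RV P >-> R}) : Prop :=
  forall (J : {set 'I_n}) (B : 'I_n -> set R),
    (forall i, measurable (B i)) ->
    P (\bigcap_(i in [set` J]) (X i @^-1` B i)) =
    (\prod_(i in J) P (X i @^-1` B i))%E.

Definition has_normal_law d (T : measurableType d) (R : realType)
    (P : probability T R) (X : {RV P >-> R}) (mu s : R) : Prop :=
  forall B : set R, measurable B -> distribution P X B = normal_prob mu s B.

(* The set where Q holds need not be measurable: it is only required to
   contain a measurable event of probability at least p. *)
Definition with_prob_at_least d (T : measurableType d) (R : realType)
    (P : probability T R) (p : R) (Q : T -> Prop) : Prop :=
  exists E : set T,
    [/\ measurable E, (p%:E <= P E)%E & forall w, E w -> Q w].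

Arguments independent_RVs {d T R} P {n} X.
Arguments has_normal_law {d T R} P X mu s.

(* Main.v *)
Require Import Defs.
From HB Require Import structures.
From mathcomp Require Import all_boot all_order all_algebra.
From mathcomp Require Import all_classical all_reals all_analysis.
From mathcomp Require Import measurable_realfun.
From mathcomp Require Import ring lra.

(** The observations behave like a sample of the average density [p], the mixture
    centred at [mu] whose mixing law is uniform on the [sigma i].  For a density
    [q], Markov's inequality bounds the probability that [q] is at least as likely
    as [p] by the expectation of the product of the [sqrt (q / p) (X i)]; by
    independence and the inequality of arithmetic and geometric means this is at
    most the [n]-th power of the affinity, the integral of [sqrt (p * q)]
    ([indep_integral_prod], [ratio_event_prob]).  The maximizer is at least as
    likely as [p], because the uniform mixing law on the [sigma i] is admissible.

    This extends to a random [q] by a union bound over a finite cover of the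
    mixtures ([mixture_cover], [EB_deviation]).  On a dyadic block of scales, the
    normal density of scale [s] is a power series in a bounded function of [s]
    that converges geometrically and uniformly in the point.  A mixture is thus
    known up to a polynomially small error from logarithmically many moments on
    logarithmically many blocks, and the cover has [expR (O (L ^+ 3))] cells,
    where [L] is the logarithmic factor of the statement.  So, with probability
    at least [1 - delta], the affinity between [p] and the estimated mixture is at
    least [1 - H ^+ 2 / 2] for some [H ^+ 2] of order [L ^+ 3 / n]
    ([cover_parameters]).

    It remains to bound the distance [D] between the centres [mu] and [nu] of [p]
    and of a mixture [q] that are so close in the Hellinger metric
    ([sym_unimodal_gap]).  Both are symmetric and unimodal, and their centres are
    their medians; hence neither puts more than [2 * H] between the centres, and by
    unimodality at most [2 * H / D] on a unit interval beyond the other centre.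
    Let [mu < nu].  The interval [[mu - 1, mu]] and its mirror image about [nu] have
    the same mass for [q].  A set of mass [P] has a mass at distance
    [O (H * sqrt P + H ^+ 2)] for a density within [H], so the [p]-masses of the two
    intervals differ by at most [4 * H * sqrt (2 * H / D) + H ^+ 2].  On the other
    hand, every component of [p] has more mass on the interval that is adjacent to
    its centre, and each of the [m] signals contributes to the difference a constant
    multiple of [(1 - expR (- D)) / n] ([uniform_mixture_gap]).  The comparison of
    both bounds gives that [D ^+ 6] when [D <= 1], and [D ^+ 2] when [1 <= D], is at
    most a multiple of [L ^+ 9 * n / m ^+ 4] ([rate_of_separation]); these are the
    two regimes of the theorem. *)

Set Implicit Arguments.
Unset Strict Implicit.
Unset Printing Implicit Defensive.

Import Order.TTheory GRing.Theory Num.Theory.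
Import numFieldNormedType.Exports.

Local Open Scope classical_set_scope.
Local Open Scope ring_scope.

(** * The Gaussian kernel and reflections of the line *)

(** Inversion is discontinuous at [0]; it is [s * (s ^+ 2) `^ (- 1)]
    everywhere. *)
Lemma measurable_invr (R : realType) : measurable_fun setT (fun s : R => s^-1).
Proof.
have -> : (fun s : R => s^-1) = (fun s => s * (s ^+ 2) `^ (- 1)).
  apply/funext => s; rewrite powR_inv1 ?sqr_ge0//.
  have [->|s0] := eqVneq s 0; first by rewrite invr0 mul0r.
  by rewrite expr2 invfM mulrA divff// mul1r.
apply: measurable_funM => //.
apply: (measurableT_comp (@measurable_powR R (- 1))).
exact: measurable_funX.
Qed.

Definition gauss_kernel (R : realType) (s y : R) : R :=
  s^-1 * normal_pdf 0 1 (y / s).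

Definition gauss_const (R : realType) : R := normal_peak 1.

Lemma gauss_const_gt0 (R : realType) : 0 < gauss_const R.
Proof. by rewrite /gauss_const normal_peak_gt0// oner_eq0. Qed.

Lemma gauss_const_le1 (R : realType) : gauss_const R <= 1.
Proof.
rewrite /gauss_const /normal_peak expr1n mul1r invf_le1; last first.
  by rewrite sqrtr_gt0 pmulrn_lgt0// pi_gt0.
rewrite -[leLHS]sqrtr1 ler_sqrt ?pmulrn_lgt0 ?pi_gt0//.
  by have := pi_ge2 R; rewrite mulr2n; lra.
by rewrite mulrn_wge0// pi_ge0.
Qed.

Lemma gauss_kernelE (R : realType) (s y : R) :
  gauss_kernel s y = gauss_const R * (s^-1 * expR (- (y / s) ^+ 2 / 2)).
Proof.
rewrite /gauss_kernel normal_pdfE ?oner_eq0// /normal_fun subr0 expr1n.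
by rewrite -/(gauss_const R) mulrCA.
Qed.

Lemma gauss_kernel_gt0 (R : realType) (s y : R) : 0 < s -> 0 < gauss_kernel s y.
Proof.
by move=> s0; rewrite gauss_kernelE !mulr_gt0 ?gauss_const_gt0 ?invr_gt0 ?expR_gt0.
Qed.

Lemma gauss_kernel_ub (R : realType) (s y : R) : 0 < s ->
  gauss_kernel s y <= s^-1.
Proof.
move=> s0; rewrite gauss_kernelE -[leRHS]mul1r ler_pM ?gauss_const_le1//.
- exact/ltW/gauss_const_gt0.
- by rewrite mulr_ge0 ?invr_ge0 ?expR_ge0 ?ltW.
rewrite -[leRHS]mulr1 ler_pM2l ?invr_gt0// expR_le1.
by have := sqr_ge0 (y / s); lra.
Qed.

Lemma gauss_kernelN (R : realType) (s y : R) :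
  gauss_kernel s (- y) = gauss_kernel s y.
Proof. by rewrite !gauss_kernelE [(- y) / s]mulNr sqrrN. Qed.

Lemma gauss_kernel_norm (R : realType) (s y : R) :
  gauss_kernel s `|y| = gauss_kernel s y.
Proof. by have [_|_] := ger0P y; rewrite ?gauss_kernelN. Qed.

Lemma gauss_kernel_anti (R : realType) (s y z : R) : 0 < s -> 0 <= y -> y <= z ->
  gauss_kernel s z <= gauss_kernel s y.
Proof.
move=> s0 y0 yz; rewrite !gauss_kernelE ler_pM2l ?gauss_const_gt0//.
rewrite ler_pM2l ?invr_gt0// ler_expR ler_pdivrMr// divfK// lerN2.
by rewrite !expr_div_n ler_pM2r ?invr_gt0 ?exprn_gt0// ler_sqr// nnegrE (le_trans y0).
Qed.

Lemma measurable_gauss_kernel (R : realType) d (T : measurableType d)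
    (D : set T) (u v : T -> R) :
  measurable_fun D u -> measurable_fun D v ->
  measurable_fun D (fun t => gauss_kernel (u t) (v t)).
Proof.
move=> mu mv; apply: measurable_funM.
  exact: (measurableT_comp (@measurable_invr R)).
apply: (measurableT_comp (@measurable_normal_pdf R 0 1)).
apply: measurable_funM => //.
exact: (measurableT_comp (@measurable_invr R)).
Qed.

Lemma normal_pdf_gauss_kernel (R : realType) (m s x : R) : 0 < s ->
  normal_pdf m s x = gauss_kernel s (x - m).
Proof.
move=> s0; rewrite normal_pdfE ?gt_eqF// gauss_kernelE mulrA; congr (_ * _).
  rewrite /gauss_const /normal_peak expr1n mul1r -mulrnAr sqrtrM ?sqr_ge0//.
  by rewrite sqrtr_sqr gtr0_norm// invfM mulrC.
rewrite /normal_fun; congr expR; rewrite expr_div_n -mulr_natr invfM.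
by rewrite !mulNr mulrA.
Qed.

Lemma integral_gauss_kernel (R : realType) (m s : R) : 0 < s ->
  (\int[lebesgue_measure]_x (gauss_kernel s (x - m))%:E = 1)%E.
Proof.
move=> s0; rewrite -(integral_normal_pdf m s).
by apply: eq_integral => x _; rewrite normal_pdf_gauss_kernel.
Qed.

Lemma lebesgue_measure_reflect (R : realType) (c : R) (A : set R) :
  measurable A ->
  pushforward lebesgue_measure
    ((fun x => c - x) : _ -> measurableTypeR R) A = lebesgue_measure A.
Proof.
have mf : measurable_fun setT
    ((fun x => c - x) : measurableTypeR R -> measurableTypeR R).
  exact: measurable_funB.
move=> mA; apply/esym.
apply: (lebesgue_measure_unique (mu := pushforward lebesgue_measure
    ((fun x => c - x) : measurableTypeR R -> measurableTypeR R))) => //= _ [[a b]] _ <-.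
rewrite /pushforward.
have -> : (fun x => c - x) @^-1` [set` `]a, b]] = `[c - b, c - a[%classic.
  by apply/seteqP; split => x /=; rewrite !in_itv/= => /andP[? ?]; apply/andP; split; lra.
rewrite /= !lebesgue_measure_itv/= !lte_fin.
by rewrite ltrD2l ltrN2; case: ifP => // _; rewrite -!EFinB; congr EFin; lra.
Qed.

Lemma ge0_integral_reflect (R : realType) (c : R) (f : R -> \bar R) :
  measurable_fun setT f -> (forall x, 0 <= f x)%E ->
  (\int[lebesgue_measure]_x f (c - x)%R = \int[lebesgue_measure]_x f x)%E.
Proof.
move=> mf f0.
have mr : measurable_fun setT
    ((fun x => c - x) : measurableTypeR R -> measurableTypeR R).
  exact: measurable_funB.
have := @ge0_integral_pushforward _ _ _ _ _ _ mr lebesgue_measure setT f.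
rewrite preimage_setT => <- //.
by apply: eq_measure_integral => A mA _; exact: lebesgue_measure_reflect.
Qed.

(** * Scale mixtures of centred normal laws *)

Section mixture.
Variables (R : realType) (smin smax : R).
Hypotheses (smin0 : 0 < smin) (sminmax : smin <= smax).
Local Notation D := (`[smin, smax]%classic : set (measurableTypeR R)).

(** The line is second countable, so that the complement of the support is a
    countable union of null intervals. *)
Lemma msupport_null (G : probability (measurableTypeR R) R) (F : set R) :
  closed F -> msupport G `<=` F -> G (~` F) = 0%E.
Proof.
move=> cF GF.
have mF : measurable (~` F : set (measurableTypeR R)).
  by apply: measurableC; exact: closed_measurable.
pose I (ab : rat * rat) : set (measurableTypeR R) :=
  `]ratr ab.1, ratr ab.2[%classic.
pose N (k : nat) : set (measurableTypeR R) :=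
  if @unpickle (rat * rat)%type k is Some ab then
    (if G (I ab) == 0%E then I ab else set0) else set0.
suff : G.-negligible (~` F) by move=> h; exact/(measure_negligible mF).
apply: (@negligibleS _ _ _ _ (\bigcup_k N k)); last first.
  apply: negligible_bigcup => k; rewrite /N.
  case: unpickle => [ab|]; last exact: negligible_set0.
  case: eqP => [I0|_]; last exact: negligible_set0.
  by exists (I ab); split => //; exact: measurable_itv.
move=> x Fx.
have /existsNP[U /not_implyP[[oU Ux] GU]] : ~ msupport G x by move=> /GF.
have mU : measurable (U : set (measurableTypeR R)) by exact: open_measurable.
have GU0 : G U = 0%E.
  by apply/eqP; rewrite eq_le measure_ge0 andbT leNgt; apply/negP.
have [e /= e0 xeU] : nbhs_ball x U.
  by rewrite nbhs_ballE; move: oU; rewrite openE => /(_ _ Ux).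
have [a] := @rat_in_itvoo R (x - e) x ltac:(lra).
rewrite in_itv/= => /andP[a1 a2].
have [b] := @rat_in_itvoo R x (x + e) ltac:(lra).
rewrite in_itv/= => /andP[b1 b2].
exists (pickle (a, b)); [by []|rewrite /N pickleK].
have IU : I (a, b) `<=` U.
  move=> y; rewrite /I /= in_itv/= => /andP[ay yb]; apply: xeU.
  by rewrite /ball/= ltr_distlC; apply/andP; split; lra.
have -> : G (I (a, b)) = 0%E.
  apply/eqP; rewrite eq_le measure_ge0 andbT -GU0 le_measure// inE//.
  exact: measurable_itv.
by rewrite eqxx /I/= in_itv/= a2 b1.
Qed.

Variable G : probability (measurableTypeR R) R.
Hypothesis GD : msupport G `<=` D.

Let mD : measurable D. Proof. exact: measurable_itv. Qed.

Lemma msupport_itv : G D = 1%E.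
Proof.
have := @msupport_null G D
  (interval_closed (a := BLeft smin) (b := BRight smax) isT isT) GD.
by rewrite probability_setC// => /eqP; rewrite sube_eq// add0e => /eqP.
Qed.

Let Dgt0 s : D s -> 0 < s.
Proof. by rewrite /= in_itv/= => /andP[? _]; exact: lt_le_trans smin0 _. Qed.

Lemma integral_cst_support (c : R) : (\int[G]_(s in D) c%:E = c%:E)%E.
Proof.
rewrite (integral_cst G mD c%:E) -[RHS]mule1; congr (_ * _)%E.
exact: msupport_itv.
Qed.

(** The expectation that defines the density ranges over the whole line, where
    the kernel of a nonpositive scale is meaningless; those scales are null. *)
Lemma mixture_integral (mu x : R) :
  ((mixture_density mu G x)%:E = \int[G]_(s in D) (gauss_kernel s (x - mu))%:E)%E.
Proof.
have mk : measurable_fun (setT : set (measurableTypeR R))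
    (fun s => (gauss_kernel s (x - mu))%:E).
  by apply/measurable_EFinP; exact: measurable_gauss_kernel.
have -> : (mixture_density mu G x)%:E =
    (fine (\int[G]_(s in D) (gauss_kernel s (x - mu))%:E))%:E.
  rewrite /mixture_density expectation.unlock; congr (fine _)%:E.
  rewrite [RHS]integral_mkcond.
  apply: ae_eq_integral => //.
    by apply/(measurable_restrictT _ mD); exact: measurable_funTS.
  exists (~` D); split; first exact: measurableC.
    exact: msupport_null
      (interval_closed (a := BLeft smin) (b := BRight smax) isT isT) GD.
  by move=> s /= + Ds; apply => _; rewrite patchE mem_set.
rewrite fineK// ge0_fin_numE; last first.
  by apply: integral_ge0 => s /Dgt0 s0; rewrite lee_fin ltW// gauss_kernel_gt0.
apply: (@le_lt_trans _ _ (\int[G]_(s in D) cst (smin^-1)%:E s)%E).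
  apply: ge0_le_integral => //.
  - by move=> s /Dgt0 s0; rewrite lee_fin ltW// gauss_kernel_gt0.
  - exact: measurable_funTS.
  move=> s Ds; rewrite lee_fin (le_trans (gauss_kernel_ub _ (Dgt0 Ds)))//.
  rewrite lef_pV2 ?posrE//; last exact: (Dgt0 Ds).
  by move: Ds; rewrite /= in_itv/= => /andP[].
by rewrite (integral_cst_support smin^-1) ltry.
Qed.

Lemma mixture_integral_le (mu x : R) (h : R -> R) :
  measurable_fun setT h ->
  (forall s, smin <= s <= smax -> gauss_kernel s (x - mu) <= h s) ->
  ((mixture_density mu G x)%:E <= \int[G]_(s in D) (h s)%:E)%E.
Proof.
move=> mh kh; rewrite mixture_integral; apply: ge0_le_integral => //.
- by move=> s /Dgt0 s0; rewrite lee_fin ltW// gauss_kernel_gt0.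
- by apply/measurable_EFinP/measurable_funTS; exact: measurable_gauss_kernel.
- exact/measurable_EFinP/measurable_funTS.
Qed.

Lemma mixture_integral_ge (mu x : R) (h : R -> R) :
  measurable_fun setT h ->
  (forall s, smin <= s <= smax -> 0 <= h s <= gauss_kernel s (x - mu)) ->
  (\int[G]_(s in D) (h s)%:E <= (mixture_density mu G x)%:E)%E.
Proof.
move=> mh kh; rewrite mixture_integral; apply: ge0_le_integral => //.
- by move=> s; rewrite /= in_itv/= => /kh /andP[? _]; rewrite lee_fin.
- exact/measurable_EFinP/measurable_funTS.
- by apply/measurable_EFinP/measurable_funTS; exact: measurable_gauss_kernel.
by move=> s; rewrite /= in_itv/= => /kh /andP[_ ?]; rewrite lee_fin.
Qed.

Lemma mixture_density_gt0 (mu x : R) : 0 < mixture_density mu G x.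
Proof.
pose c := smax^-1 * (gauss_const R * expR (- ((x - mu) / smin) ^+ 2 / 2)).
have smax0 : 0 < smax by exact: lt_le_trans sminmax.
have c0 : 0 < c.
  by rewrite mulr_gt0 ?invr_gt0// mulr_gt0 ?expR_gt0// gauss_const_gt0.
apply: (lt_le_trans c0); rewrite -lee_fin -integral_cst_support.
apply: mixture_integral_ge => // s /andP[s1 s2]; rewrite (ltW c0)/=.
have s0 : 0 < s by exact: lt_le_trans s1.
rewrite /c gauss_kernelE mulrCA ler_pM2l ?gauss_const_gt0//.
apply: ler_pM; rewrite ?invr_ge0 ?expR_ge0 ?(ltW smax0) ?lef_pV2//.
rewrite ler_expR ler_pM2r// lerN2 !expr_div_n ler_wpM2l ?sqr_ge0//.
by rewrite lef_pV2 ?posrE ?exprn_gt0// ler_sqr// nnegrE ltW.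
Qed.

Lemma mixture_density_ge0 (mu x : R) : 0 <= mixture_density mu G x.
Proof. exact/ltW/mixture_density_gt0. Qed.

(** Each component decreases with the distance to the centre, and the mixing
    law does not see the centre. *)
Lemma mixture_density_anti (mu nu x y : R) : `|x - mu| <= `|y - nu| ->
  mixture_density nu G y <= mixture_density mu G x.
Proof.
move=> xy; rewrite -lee_fin mixture_integral; apply: mixture_integral_ge.
  exact: measurable_gauss_kernel.
move=> s /andP[s1 s2]; have s0 : 0 < s by exact: lt_le_trans s1.
rewrite ltW ?gauss_kernel_gt0//=.
rewrite -gauss_kernel_norm -(gauss_kernel_norm s (x - mu)).
exact: gauss_kernel_anti.
Qed.

Lemma mixture_density_center (mu x y nu : R) : `|x - mu| = `|y - nu| ->
  mixture_density nu G y = mixture_density mu G x.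
Proof. by move=> h; apply/eqP; rewrite eq_le !mixture_density_anti// h. Qed.

Let mjoint (mu : R) : measurable_fun setT
  (fun z : measurableTypeR R * measurableTypeR R =>
     ((gauss_kernel z.1 (z.2 - mu)) * \1_D z.1)%:E).
Proof.
apply/measurable_EFinP; apply: measurable_funM.
  apply: measurable_gauss_kernel; first exact: measurable_fst.
  by apply: measurable_funB => //; exact: measurable_snd.
apply: (measurableT_comp (measurable_indic mD)); exact: measurable_fst.
Qed.

Let joint_ge0 (mu : R) (z : measurableTypeR R * measurableTypeR R) :
  (0 <= ((gauss_kernel z.1 (z.2 - mu)) * \1_D z.1)%:E)%E.
Proof.
rewrite lee_fin indicE; have [zD|_] := boolP (z.1 \in D); last by rewrite mulr0.
by rewrite mulr1 ltW// gauss_kernel_gt0// Dgt0// -inE.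
Qed.

Let mixture_integral_indic (mu x : R) :
  ((mixture_density mu G x)%:E =
   \int[G]_s (gauss_kernel s (x - mu) * \1_D s)%:E)%E.
Proof.
rewrite mixture_integral integral_mkcond; apply: eq_integral => s _.
by rewrite patchE indicE; case: ifP => _; rewrite ?mulr1 ?mulr0.
Qed.

Lemma measurable_mixture_density (mu : R) :
  measurable_fun setT (mixture_density mu G).
Proof.
apply/measurable_EFinP.
have := @measurable_fun_fubini_tonelli_G _ _ _ _ R G _ (mjoint mu) (joint_ge0 mu).
by apply: eq_measurable_fun => x _; rewrite /= mixture_integral_indic.
Qed.

Lemma integral_mixture_density (mu : R) :
  (\int[lebesgue_measure]_x (mixture_density mu G x)%:E = 1)%E.
Proof.
under eq_integral do rewrite mixture_integral_indic.
have /= <- := @fubini_tonelli _ _ _ _ R G lebesgue_measure _ (mjoint mu) (joint_ge0 mu).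
rewrite -[RHS](integral_cst_support 1) [RHS]integral_mkcond.
apply: eq_integral => s _; rewrite patchE.
under eq_integral do rewrite indicE.
have [sD|sD] := boolP (s \in D).
  under eq_integral do rewrite mulr1.
  by rewrite integral_gauss_kernel// Dgt0// -inE.
under eq_integral do rewrite mulr0.
by rewrite integral0.
Qed.

End mixture.

(** * Masses and Hellinger affinity of densities *)

Section hellinger.
Variable R : realType.
Local Notation leb := (@lebesgue_measure R).
Implicit Types (p q : R -> R) (A B : set (measurableTypeR R)).

Definition density p := [/\ measurable_fun setT p, forall x, 0 <= p x
  & (\int[leb]_x (p x)%:E = 1)%E].

Definition mass p A : R := \int[leb]_(x in A) p x.

Definition affinity p q : R := \int[leb]_x (Num.sqrt (p x) * Num.sqrt (q x)).

Lemma measurable_sqrt_comp d (T : measurableType d) (D : set T) (f : T -> R) :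
  (forall x, 0 <= f x) -> measurable_fun D f ->
  measurable_fun D (fun x => Num.sqrt (f x)).
Proof.
move=> f0 mf; under eq_fun do rewrite -powR12_sqrt//.
exact: (measurableT_comp (@measurable_powR R 2^-1)).
Qed.

Lemma density_integrable p A : density p -> measurable A ->
  leb.-integrable A (EFin \o p).
Proof.
move=> [mp p0 p1] mA; apply: (@integrableS _ _ _ _ setT) => //.
apply/integrableP; split; first exact/measurable_EFinP.
under eq_integral do rewrite /= ger0_norm//.
by rewrite p1 ltry.
Qed.

Lemma massE p A : density p -> measurable A ->
  (mass p A)%:E = (\int[leb]_(x in A) (p x)%:E)%E.
Proof.
move=> dp mA; rewrite fineK//; apply: integrable_fin_num => //.
exact: density_integrable.
Qed.

Lemma mass_ge0 p A : density p -> 0 <= mass p A.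
Proof. by move=> [_ p0 _]; apply: Rintegral_ge0. Qed.

Lemma mass_setT p : density p -> mass p setT = 1.
Proof. by move=> [_ _ p1]; rewrite /mass /Rintegral p1. Qed.

Lemma mass_setU p A B : density p -> measurable A -> measurable B ->
  [disjoint A & B] -> mass p (A `|` B) = mass p A + mass p B.
Proof.
move=> dp mA mB AB; apply: Rintegral_setU => //.
by apply: density_integrable => //; exact: measurableU.
Qed.

Lemma mass_setC p A : density p -> measurable A ->
  mass p (~` A) = 1 - mass p A.
Proof.
move=> dp mA; apply/eqP; rewrite eq_sym subr_eq -(mass_setT dp) -(setvU A).
rewrite mass_setU//; first exact: measurableC.
by rewrite disj_set2E setICl.
Qed.

Lemma mass_le1 p A : density p -> measurable A -> mass p A <= 1.
Proof.
by move=> dp mA; rewrite -subr_ge0 -mass_setC// mass_ge0.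
Qed.

Lemma affinity_integrable p q A : density p -> density q -> measurable A ->
  leb.-integrable A (EFin \o (fun x => Num.sqrt (p x) * Num.sqrt (q x))).
Proof.
move=> dp dq mA; have [mp p0 p1] := dp; have [mq q0 q1] := dq.
apply: (le_integrable mA (g := EFin \o (fun x => p x + q x))) => //.
- apply/measurable_EFinP; apply: measurable_funM; apply: measurable_sqrt_comp => //;
  exact: measurable_funTS.
- move=> x _; rewrite lee_fin !ger0_norm ?mulr_ge0 ?addr_ge0 ?sqrtr_ge0//.
  have := sqr_ge0 (Num.sqrt (p x) - Num.sqrt (q x)).
  rewrite sqrrB !sqr_sqrtr//; have := p0 x; have := q0 x; lra.
- have := @integrableD _ _ _ leb A mA (EFin \o p) (EFin \o q).
  by apply; exact: density_integrable.
Qed.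

Lemma affinityE p q : density p -> density q -> (affinity p q)%:E =
  (\int[leb]_x (Num.sqrt (p x) * Num.sqrt (q x))%:E)%E.
Proof.
move=> dp dq; rewrite fineK//; apply: integrable_fin_num => //.
exact: affinity_integrable.
Qed.

(** The discriminant of a nonnegative quadratic polynomial in [s]. *)
Lemma le_sqrt_of_quadratic_ge0 (a b r : R) : 0 <= a -> 0 <= b ->
  (forall s, 0 <= a + s ^+ 2 * b - 2 * s * r) -> r <= Num.sqrt a * Num.sqrt b.
Proof.
move=> a0 b0 h; have [r0|r0] := leP r 0.
  by rewrite (le_trans r0)// mulr_ge0 ?sqrtr_ge0.
rewrite -sqrtrM// -[leLHS]gtr0_norm// -sqrtr_sqr ler_sqrt ?mulr_ge0//.
move: b0; rewrite le_eqVlt => /predU1P[b0|b0].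
  have := h ((a + 1) / (2 * r)); rewrite -b0 mulr0 addr0.
  have -> : 2 * ((a + 1) / (2 * r)) * r = a + 1 by field; rewrite gt_eqF.
  by move=> ?; exfalso; lra.
have := h (r / b).
have -> : a + (r / b) ^+ 2 * b - 2 * (r / b) * r = (a * b - r ^+ 2) / b.
  by field; rewrite gt_eqF.
by rewrite ler_pdivlMr// mul0r subr_ge0.
Qed.

(** The Cauchy-Schwarz inequality, from the integral over [A] of the square of
    [Num.sqrt p - s * Num.sqrt q]. *)
Lemma affinity_on_le p q A : density p -> density q -> measurable A ->
  \int[leb]_(x in A) (Num.sqrt (p x) * Num.sqrt (q x)) <=
  Num.sqrt (mass p A) * Num.sqrt (mass q A).
Proof.
move=> dp dq mA; have [mp p0 p1] := dp; have [mq q0 q1] := dq.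
apply: le_sqrt_of_quadratic_ge0; rewrite ?mass_ge0// => s.
rewrite /mass.
have ip := density_integrable dp mA; have iq := density_integrable dq mA.
have ipq := affinity_integrable dp dq mA.
have isq : leb.-integrable A (EFin \o (fun x => s ^+ 2 * q x)).
  exact: (integrableZl mA (s ^+ 2) iq).
have ispq : leb.-integrable A
    (EFin \o (fun x => 2 * s * (Num.sqrt (p x) * Num.sqrt (q x)))).
  exact: (integrableZl mA (2 * s) ipq).
rewrite -(RintegralZl (s ^+ 2) mA iq) -(RintegralZl (2 * s) mA ipq).
rewrite -(RintegralD mA ip isq) -(RintegralB mA (integrableD mA ip isq) ispq).
apply: Rintegral_ge0 => x _.
have -> : p x + s ^+ 2 * q x - 2 * s * (Num.sqrt (p x) * Num.sqrt (q x)) =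
    (Num.sqrt (p x) - s * Num.sqrt (q x)) ^+ 2.
  by rewrite sqrrB exprMn !sqr_sqrtr//; ring.
exact: sqr_ge0.
Qed.

Lemma affinity_le_two_cells p q A : density p -> density q -> measurable A ->
  affinity p q <= Num.sqrt (mass p A) * Num.sqrt (mass q A) +
    Num.sqrt (1 - mass p A) * Num.sqrt (1 - mass q A).
Proof.
move=> dp dq mA; have mAC := measurableC mA.
rewrite -!mass_setC// /affinity -(setUv A) Rintegral_setU//.
- by rewrite lerD// affinity_on_le.
- by rewrite setUv; exact: affinity_integrable.
- by rewrite disj_set2E setICr.
Qed.

(** Data processing: merging the line into [A] and its complement does not
    increase the Hellinger distance. *)
Lemma sqrt_mass_dist p q A (H : R) : density p -> density q -> measurable A ->
  0 <= H -> 1 - H ^+ 2 / 2 <= affinity p q ->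
  `|Num.sqrt (mass p A) - Num.sqrt (mass q A)| <= H.
Proof.
move=> dp dq mA H0 /le_trans/(_ (affinity_le_two_cells dp dq mA)) h.
have P0 := mass_ge0 A dp; have Q0 := mass_ge0 A dq.
have P1 := mass_le1 dp mA; have Q1 := mass_le1 dq mA.
set P := mass p A in h P0 P1 *; set Q := mass q A in h Q0 Q1 *; clearbody P Q.
rewrite -ler_sqr ?nnegrE ?normr_ge0// real_normK ?num_real//.
have := sqr_ge0 (Num.sqrt (1 - P) - Num.sqrt (1 - Q)).
rewrite !sqrrB !sqr_sqrtr ?subr_ge0//; move: h.
lra.
Qed.

(** The distance is of the order of [H] times the square root of the masses:
    this is what improves on the total variation distance for sets of small
    mass. *)
Lemma mass_dist p q A (H : R) : density p -> density q -> measurable A ->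
  0 <= H -> 1 - H ^+ 2 / 2 <= affinity p q ->
  `|mass p A - mass q A| <= H * (Num.sqrt (mass p A) + Num.sqrt (mass q A)).
Proof.
move=> dp dq mA H0 /(sqrt_mass_dist dp dq mA H0) h.
have P0 := mass_ge0 A dp; have Q0 := mass_ge0 A dq.
rewrite -{1}(sqr_sqrtr P0) -{1}(sqr_sqrtr Q0) subr_sqr normrM.
rewrite [X in _ * X]ger0_norm ?addr_ge0 ?sqrtr_ge0//.
by rewrite ler_wpM2r// addr_ge0 ?sqrtr_ge0.
Qed.

End hellinger.

(** * Close symmetric unimodal densities *)

Section unimodal.
Variable R : realType.
Local Notation leb := (@lebesgue_measure R).
Implicit Types (p q : R -> R) (A B : set (measurableTypeR R)).

Definition sym_unimodal (a : R) p :=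
  forall x y, `|x - a| <= `|y - a| -> p y <= p x.

Lemma sym_unimodal_reflect a p x : sym_unimodal a p -> p (2 * a - x) = p x.
Proof.
move=> up; apply/eqP; rewrite eq_le.
have e : `|2 * a - x - a| = `|x - a|.
  by rewrite -[RHS]normrN; congr `|_|; ring.
by rewrite !up// e.
Qed.

Lemma mass_reflect c p A : measurable_fun setT p -> (forall x, 0 <= p x) ->
  measurable A ->
  mass p A = mass (fun x => p (c - x)) [set x | A (c - x)].
Proof.
move=> mp p0 mA; rewrite /mass /Rintegral; congr fine.
rewrite integral_mkcond [RHS]integral_mkcond -(ge0_integral_reflect c).
- apply: eq_integral => x _; rewrite !patchE.
  suff -> : (x \in [set y | A (c - y)]) = (c - x \in A) by [].
  by apply/idP/idP; rewrite !inE.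
- apply/(measurable_restrictT _ mA).
  exact/measurable_EFinP/measurable_funTS.
- by move=> x; rewrite patchE; case: ifP => // _; rewrite lee_fin.
Qed.

Lemma affinity_reflect c p q : density p -> density q ->
  affinity (fun x => p (c - x)) (fun x => q (c - x)) = affinity p q.
Proof.
move=> [mp p0 _] [mq q0 _]; rewrite /affinity /Rintegral; congr fine.
apply: (ge0_integral_reflect c
  (f := fun x => (Num.sqrt (p x) * Num.sqrt (q x))%:E)).
  by apply/measurable_EFinP; apply: measurable_funM; exact: measurable_sqrt_comp.
by move=> x; rewrite lee_fin mulr_ge0// sqrtr_ge0.
Qed.

Let mI (u v : R) : measurable (`[u, v]%classic : set (measurableTypeR R)).
Proof. exact: measurable_itv. Qed.

Let integral_cst_itv (u v c : R) : u <= v ->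
  (\int[leb]_(x in `[u, v]) c%:E = (c * (v - u))%:E)%E.
Proof.
move=> uv; have luv : lebesgue_measure (`[u, v]%classic : set R) =
    (if u < v then (v - u)%:E else 0%E) by rewrite lebesgue_measure_itv/= lte_fin.
transitivity (c%:E * lebesgue_measure (`[u, v]%classic : set R))%E.
  exact: integral_cst.
rewrite luv.
case: ltP => [_|vu] //=; rewrite mule0; congr EFin.
by rewrite (_ : v - u = 0) ?mulr0//; lra.
Qed.

Lemma mass_itv_ub p (u v c : R) : density p -> u <= v ->
  (forall x, u <= x <= v -> p x <= c) -> mass p `[u, v] <= c * (v - u).
Proof.
move=> dp uv pc; have [mp p0 _] := dp.
rewrite -lee_fin massE// -integral_cst_itv//; apply: ge0_le_integral => //.
- by move=> x _; rewrite lee_fin.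
- exact/measurable_EFinP/measurable_funTS.
Qed.

Lemma mass_itv_lb p (u v c : R) : density p -> u <= v -> 0 <= c ->
  (forall x, u <= x <= v -> c <= p x) -> c * (v - u) <= mass p `[u, v].
Proof.
move=> dp uv c0 pc; have [mp p0 _] := dp.
rewrite -lee_fin massE// -integral_cst_itv//; apply: ge0_le_integral => //.
by apply/measurable_EFinP; exact: measurable_funTS.
Qed.

Lemma mass_half a p : density p -> sym_unimodal a p ->
  mass p `]-oo, a] = 2^-1.
Proof.
move=> dp up; have [mp p0 _] := dp.
have mL : measurable (`]-oo, a]%classic : set (measurableTypeR R)).
  exact: measurable_itv.
have : mass p `]-oo, a] = 1 - mass p `]-oo, a].
  rewrite -mass_setC//.
  have -> : ~` `]-oo, a] = `]a, +oo[%classic :> set R.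
    by rewrite setCitvl.
  rewrite {2}/mass Rintegral_itv_obnd_cbnd; last first.
    by apply: density_integrable => //; exact: measurable_itv.
  rewrite (mass_reflect (2 * a))//.
  have -> : [set x | `]-oo, a]%classic (2 * a - x)] = `[a, +oo[%classic :> set R.
    by apply/seteqP; split => x /=; rewrite !in_itv/= ?andbT => ?; lra.
  by apply: eq_Rintegral => x _; rewrite sym_unimodal_reflect.
lra.
Qed.

Lemma mass_half_right a p : density p -> sym_unimodal a p ->
  mass p `[a, +oo[ = 2^-1.
Proof.
move=> dp up; rewrite -(mass_half dp up) /mass -Rintegral_itv_obnd_cbnd; last first.
  by apply: density_integrable => //; exact: measurable_itv.
have -> : `]a, +oo[%classic = ~` `]-oo, a] :> set R by rewrite setCitvl.
have mL : measurable (`]-oo, a]%classic : set (measurableTypeR R)).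
  exact: measurable_itv.
have := mass_setC dp mL; rewrite /mass => ->.
by have := mass_half dp up; rewrite /mass => ->; lra.
Qed.

Lemma mass_itvNyc p (u v : R) : density p -> u <= v ->
  mass p `]-oo, v] = mass p `]-oo, u] + mass p `[u, v].
Proof.
move=> dp uv.
have e : mass p `[u, v] = mass p `]u, v].
  rewrite /mass -Rintegral_itv_obnd_cbnd//.
  by apply: density_integrable => //; exact: measurable_itv.
rewrite e -mass_setU//; try exact: measurable_itv.
  congr (mass p _); apply/seteqP; split => x /=; rewrite !in_itv/=.
    by move=> xv; case: (lerP x u) => xu; [left|right].
  by case=> [|/andP[] //]; move=> /le_trans; apply.
rewrite disj_set2E; apply/eqP/seteqP; split => x //= [].
by rewrite !in_itv/= => xu /andP[ux _]; lra.
Qed.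

Lemma mass_itvcy p (u v : R) : density p -> u <= v ->
  mass p `[u, +oo[ = mass p `[u, v] + mass p `[v, +oo[.
Proof.
move=> dp uv.
have e : mass p `[v, +oo[ = mass p `]v, +oo[.
  rewrite /mass -Rintegral_itv_obnd_cbnd//.
  by apply: density_integrable => //; exact: measurable_itv.
rewrite e -mass_setU//; try exact: measurable_itv.
  congr (mass p _); apply/seteqP; split => x /=; rewrite !in_itv/= !andbT.
    by move=> ux; case: (lerP x v) => xv; [left; rewrite ux|right].
  by case=> [/andP[] //|vx]; lra.
rewrite disj_set2E; apply/eqP/seteqP; split => x //= [].
by rewrite !in_itv/= andbT => /andP[_ xv] vx; lra.
Qed.

(** If two symmetric unimodal densities with centres [a < b] are close, then
    each puts little mass between the centres, since both centres are medians;
    unimodality then bounds the masses of the far intervals, and a small mass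
    has a small fluctuation in the Hellinger metric.  The mirror images
    [[a - 1, a]] and [[2b - a, 2b - a + 1]] with respect to [b] have the same
    mass for [q], whence a bound on their masses' difference for [p]. *)
Lemma sym_unimodal_gap a b p q (H : R) : a < b ->
  density p -> sym_unimodal a p -> density q -> sym_unimodal b q ->
  0 <= H -> 1 - H ^+ 2 / 2 <= affinity p q ->
  mass p `[a - 1, a] - mass p `[2 * b - a, 2 * b - a + 1] <=
  4 * H * Num.sqrt (2 * H / (b - a)) + H ^+ 2.
Proof.
move=> ab dp up dq uq H0 aff.
have [mp p0 _] := dp; have [mq q0 _] := dq.
have ba0 : 0 < b - a by lra.
set I : set (measurableTypeR R) := `[a - 1, a]%classic.
set I' : set (measurableTypeR R) := `[2 * b - a, 2 * b - a + 1]%classic.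
have tv A : measurable A -> `|mass p A - mass q A| <= 2 * H.
  move=> mA; apply: le_trans (mass_dist dp dq mA H0 aff) _.
  rewrite mulrC ler_wpM2r//.
  have s1 r : density r -> Num.sqrt (mass r A) <= 1.
    by move=> dr; rewrite -[leRHS]sqrtr1 ler_sqrt ?mass_le1.
  by have := s1 _ dp; have := s1 _ dq; lra.
have pab : mass p `[a, b] <= 2 * H.
  have := tv `]-oo, b]%classic (measurable_itv _).
  rewrite (mass_half dq uq) (mass_itvNyc dp (ltW ab)) (mass_half dp up).
  by rewrite addrAC subrr add0r ger0_norm// mass_ge0.
have qab : mass q `[a, b] <= 2 * H.
  have := tv `[a, +oo[%classic (measurable_itv _).
  rewrite (mass_half_right dp up) (mass_itvcy dq (ltW ab)) (mass_half_right dq uq).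
  by rewrite ler_norml => /andP[+ _]; lra.
have pI' : mass p I' <= 2 * H / (b - a).
  rewrite ler_pdivlMr//; apply: le_trans pab.
  apply: (@le_trans _ _ (p b * (b - a))); last first.
    apply: mass_itv_lb => //; first exact: ltW.
    by move=> x /andP[ax xb]; apply: up; rewrite !ger0_norm; lra.
  rewrite ler_pM2r//; have -> : p b = p b * (2 * b - a + 1 - (2 * b - a)) by ring.
  apply: mass_itv_ub => //; first lra.
  by move=> x /andP[ax xb]; apply: up; rewrite !ger0_norm; lra.
have qI : mass q I <= 2 * H / (b - a).
  rewrite ler_pdivlMr//; apply: le_trans qab.
  apply: (@le_trans _ _ (q a * (b - a))); last first.
    apply: mass_itv_lb => //; first exact: ltW.
    move=> x /andP[ax xb]; apply: uq.
    by rewrite !ler0_norm; lra.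
  rewrite ler_pM2r//; have -> : q a = q a * (a - (a - 1)) by ring.
  apply: mass_itv_ub => //; first lra.
  move=> x /andP[ax xb]; apply: uq.
  by rewrite !ler0_norm; lra.
have qII' : mass q I' = mass q I.
  rewrite (mass_reflect (2 * b) (A := I'))//; last exact: measurable_itv.
  have -> : [set x | I' (2 * b - x)] = I.
    by rewrite /I /I'; apply/seteqP; split => x /=; rewrite !in_itv/= => ?; lra.
  by apply: eq_Rintegral => x _; rewrite sym_unimodal_reflect.
have mI1 : measurable I by exact: measurable_itv.
have mI2 : measurable I' by exact: measurable_itv.
have := mass_dist dp dq mI1 H0 aff; have := mass_dist dp dq mI2 H0 aff.
have := sqrt_mass_dist dp dq mI1 H0 aff.
rewrite qII' !ler_norml.
have sq c : 0 <= c <= 2 * H / (b - a) -> Num.sqrt c <= Num.sqrt (2 * H / (b - a)).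
  by move=> /andP[c0 cH]; rewrite ler_sqrt// (le_trans c0).
have := sq _ (introT andP (conj (mass_ge0 I' dp) pI')).
have := sq _ (introT andP (conj (mass_ge0 I dq) qI)).
clear - H0.
move: (mass p I) (mass p I') (mass q I) (Num.sqrt (2 * H / (b - a)))
  (Num.sqrt (mass p I)) (Num.sqrt (mass p I')) (Num.sqrt (mass q I))
  => P P' Q s u u' v.
move=> vs u's /andP[_ h1] /andP[h2 _] /andP[_ h3].
have : H * (u' + v) <= H * (2 * s) by rewrite ler_wpM2l//; lra.
have : H * (u + v) <= H * (2 * s + H) by rewrite ler_wpM2l//; lra.
rewrite expr2; lra.
Qed.

End unimodal.

(** * The gap produced by a signal *)

Section signal_gap.
Variable R : realType.
Local Notation leb := (@lebesgue_measure R).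
Local Notation kern a s := (fun x : R => gauss_kernel s (x - a)).

Lemma density_gauss_kernel (a s : R) : 0 < s -> density (kern a s).
Proof.
move=> s0; split; last exact: integral_gauss_kernel.
  by apply: measurable_gauss_kernel => //; exact: measurable_funB.
by move=> x; exact/ltW/gauss_kernel_gt0.
Qed.

(** Half of the value at one standard deviation of the standard normal
    density: the [s / 2]-wide interval of [gauss_kernel_drop] carries a gain
    proportional to [gauss_kernel s s], and the powers of [s] cancel. *)
Definition signal_const : R := gauss_const R * expR (- 2^-1) / 2.

Lemma signal_const_gt0 : 0 < signal_const.
Proof. by rewrite divr_gt0// mulr_gt0 ?expR_gt0 ?gauss_const_gt0. Qed.

(** At distance [y] in [[s / 2, s]] from the centre, moving away by
    [2 * d] costs a factor [expR (- d)], whatever the scale [s <= 1]. *)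
Lemma gauss_kernel_drop (s y d : R) : 0 < s <= 1 -> s / 2 <= y <= s -> 0 < d ->
  gauss_kernel s (y + 2 * d) + (signal_const * 2 / s) * (1 - expR (- d)) <=
  gauss_kernel s y.
Proof.
move=> /andP[s0 s1] /andP[y1 y2] d0.
have -> : signal_const * 2 / s = gauss_kernel s s.
  rewrite gauss_kernelE divff ?gt_eqF// expr1n /signal_const mulN1r.
  by rewrite divfK// mulrAC mulrA.
have y0 : 0 <= y by apply: le_trans y1; rewrite divr_ge0 ?ltW.
have h1 : gauss_kernel s s <= gauss_kernel s y by exact: gauss_kernel_anti.
have h2 : gauss_kernel s (y + 2 * d) <= gauss_kernel s y * expR (- d).
  rewrite !gauss_kernelE -!mulrA ler_pM2l ?gauss_const_gt0//.
  rewrite ler_pM2l ?invr_gt0// -expRD ler_expR.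
  rewrite -subr_ge0.
  have -> : - (y / s) ^+ 2 / 2 - d - - ((y + 2 * d) / s) ^+ 2 / 2 =
     (2 * d ^+ 2 + d * (2 * y - s) + d * s * (1 - s)) / s ^+ 2.
    by field; rewrite gt_eqF.
  rewrite divr_ge0 ?sqr_ge0// !addr_ge0//.
  - by rewrite mulr_ge0// sqr_ge0.
  - by rewrite mulr_ge0 ?(ltW d0)//; lra.
  - by rewrite !mulr_ge0 ?(ltW d0) ?(ltW s0)//; lra.
have e0 : 0 <= 1 - expR (- d).
  by rewrite subr_ge0 expR_le1 oppr_le0 ltW.
apply: le_trans (lerD h2 (ler_wpM2r e0 h1)) _.
by rewrite mulrBr mulr1 addrC subrK.
Qed.

(** The mirror interval lies farther from the centre, so that the difference is
    nonnegative for every scale; for a signal, the drop of the kernel is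
    integrated over the points at distance [s / 2] to [s] from the centre. *)
Lemma gauss_kernel_gap (a b s : R) : a < b -> 0 < s ->
  (if s <= 1 then signal_const * (1 - expR (- (b - a))) else 0) <=
  mass (kern a s) `[a - 1, a] -
  mass (kern a s) `[2 * b - a, 2 * b - a + 1].
Proof.
move=> ab s0; have dk := density_gauss_kernel a s0; have [mk k0 _] := dk.
set I : set (measurableTypeR R) := `[a - 1, a]%classic.
set I' : set (measurableTypeR R) := `[2 * b - a, 2 * b - a + 1]%classic.
have mI : measurable I by exact: measurable_itv.
have mI' : measurable I' by exact: measurable_itv.
set r := kern (2 * b - a) s.
have dr : density r := density_gauss_kernel _ s0.
have [mr r0 _] := dr.
have -> : mass (kern a s) I' = mass r I.
  rewrite (mass_reflect (2 * b) mk k0 mI').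
  have -> : [set x | I' (2 * b - x)] = I.
    by rewrite /I /I'; apply/seteqP; split => x /=; rewrite !in_itv/= => ?; lra.
  by apply: eq_Rintegral => x _; rewrite /r -gauss_kernelN; congr gauss_kernel; ring.
have rk x : I x -> r x <= kern a s x.
  rewrite /I/= in_itv/= => /andP[ax xa].
  rewrite /r /= -(gauss_kernelN s (x - a)) -(gauss_kernelN s (x - (2 * b - a))).
  by apply: gauss_kernel_anti => //; lra.
case: ifP => [s1|_]; last first.
  rewrite subr_ge0; apply: le_Rintegral => //; exact: density_integrable.
pose J : set (measurableTypeR R) := `[a - s, a - s / 2]%classic.
have mJ : measurable J by exact: measurable_itv.
have lJ : lebesgue_measure (`[a - s, a - s / 2]%classic : set R) = (s / 2)%:E.
  rewrite lebesgue_measure_itv/= lte_fin ifT; last by lra.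
  by rewrite -EFinB; congr EFin; lra.
have JI : J `<=` I.
  by move=> x; rewrite /I /J /= !in_itv/= => /andP[? ?]; apply/andP; split; lra.
pose c := (signal_const * 2 / s) * (1 - expR (- (b - a))).
have c0 : 0 <= c.
  apply: mulr_ge0; last by rewrite subr_ge0 expR_le1; lra.
  by apply: divr_ge0; [apply: mulr_ge0 => //|]; rewrite ltW// signal_const_gt0.
rewrite lerBrDl -lee_fin EFinD !massE//.
have <- : (\int[leb]_(x in I) (c * \1_J x)%:E)%E =
    (signal_const * (1 - expR (- (b - a))))%:E.
  under eq_integral do rewrite EFinM.
  rewrite ge0_integralZl_EFin//; last first.
    exact/measurable_EFinP/measurable_funTS/measurable_indic.
  rewrite integral_indic// setIidl//.
  transitivity (c%:E * (s / 2)%:E)%E.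
    congr (_ * _)%E; exact: lJ.
  by rewrite -EFinM /c; congr EFin; field; rewrite gt_eqF.
rewrite -ge0_integralD//; last 4 first.
- by move=> x _; rewrite lee_fin.
- exact/measurable_EFinP/measurable_funTS.
- by move=> x _; rewrite lee_fin mulr_ge0.
- by apply/measurable_EFinP; apply: measurable_funM.
apply: ge0_le_integral => //.
- by move=> x _; apply: adde_ge0; rewrite lee_fin// mulr_ge0.
- apply: emeasurable_funD; first exact/measurable_EFinP/measurable_funTS.
  by apply/measurable_EFinP; apply: measurable_funM.
- exact/measurable_EFinP/measurable_funTS.
move=> x Ix; rewrite -EFinD lee_fin indicE.
have [xJ|_] := boolP (x \in J); last by rewrite mulr0 addr0 rk.
rewrite mulr1; move: xJ; rewrite inE /J/= in_itv/= => /andP[x1 x2].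
have := @gauss_kernel_drop s (a - x) (b - a).
rewrite s0 s1 => /(_ isT); rewrite -/c.
have -> : a - x + 2 * (b - a) = - (x - (2 * b - a)) by ring.
have -> : a - x = - (x - a) by ring.
rewrite !gauss_kernelN; apply; last lra.
by apply/andP; split; lra.
Qed.

End signal_gap.

(** * The uniform mixing law *)

Lemma density_mixture (R : realType) (smin smax mu : R)
    (G : probability (measurableTypeR R) R) :
  0 < smin -> smin <= smax -> msupport G `<=` `[smin, smax] ->
  density (mixture_density mu G).
Proof.
move=> s0 s12 GD; split.
- exact: (measurable_mixture_density s0 GD).
- by move=> x; exact: (mixture_density_ge0 s0 s12 GD).
- exact: (integral_mixture_density s0 GD).
Qed.

Lemma sym_unimodal_mixture (R : realType) (smin smax mu : R)
    (G : probability (measurableTypeR R) R) :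
  0 < smin -> smin <= smax -> msupport G `<=` `[smin, smax] ->
  sym_unimodal mu (mixture_density mu G).
Proof. by move=> s0 s12 GD x y; exact: (mixture_density_anti s0 GD). Qed.

Section uniform_mixing.
Variables (R : realType) (n : nat) (sigma : 'I_n -> R).
Hypothesis n0 : (0 < n)%N.
Local Notation TR := (measurableTypeR R).

(** The finite sums of measures are indexed by natural numbers; the value [0] is
    only taken from [n] on. *)
Definition sigma_nat (k : nat) : TR := oapp sigma 0 (insub k).

Definition sigma_atoms : {measure set TR -> \bar R} :=
  msum (fun k => dirac (sigma_nat k)) n.

Definition uniform_mixing : probability TR R :=
  mnormalize sigma_atoms (dirac (0 : TR)).

Let atomsE (U : set TR) :
  sigma_atoms U = (\sum_(i < n) \d_(sigma i : TR) U)%E.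
Proof.
apply: eq_bigr => i _; rewrite /sigma_nat.
by have -> : insub (i : nat) = Some i by exact: valK.
Qed.

Let atomsT : sigma_atoms setT = n%:R%:E.
Proof.
rewrite atomsE (eq_bigr (fun=> 1%E)); last by move=> i _; rewrite diracT.
by rewrite sumEFin sumr_const card_ord.
Qed.

Lemma uniform_mixingE (U : set TR) :
  uniform_mixing U = (n%:R^-1%:E * \sum_(i < n) \d_(sigma i : TR) U)%E.
Proof.
rewrite -atomsE; change (mnormalize sigma_atoms (dirac (0%R : TR)) U =
  n%:R^-1%:E * sigma_atoms U)%E.
rewrite /mnormalize atomsT /=.
by rewrite eqe pnatr_eq0 eqn0Ngt n0/= muleC.
Qed.

Lemma integral_uniform_mixing (D : set TR) (f : TR -> \bar R) :
  measurable D -> (forall i, D (sigma i)) ->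
  measurable_fun D f -> (forall x, D x -> 0 <= f x)%E ->
  (\int[uniform_mixing]_(x in D) f x = n%:R^-1%:E * \sum_(i < n) f (sigma i))%E.
Proof.
move=> mD Ds mf f0.
have ni0 : 0 <= n%:R^-1 :> R by rewrite invr_ge0.
rewrite (@eq_measure_integral _ _ _ _ (mscale (NngNum ni0) sigma_atoms)); last first.
  move=> A mA _; transitivity (n%:R^-1%:E * sigma_atoms A)%E => //.
  by rewrite atomsE; exact: uniform_mixingE.
rewrite ge0_integral_mscale//=; congr (_ * _)%E.
rewrite ge0_integral_measure_sum//; apply: eq_bigr => i _.
rewrite /sigma_nat; have -> : insub (i : nat) = Some i by exact: valK.
by rewrite integral_dirac//= diracE mem_set// mul1e.
Qed.

Lemma uniform_mixing_support (smin smax : R) :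
  (forall i, smin <= sigma i <= smax) ->
  msupport uniform_mixing `<=` `[smin, smax].
Proof.
move=> sb x; apply: contraPP => xD Gx.
have oU : open_nbhs x (~` `[smin, smax]%classic).
  split => //; apply: closed_openC; exact: interval_closed.
have := Gx _ oU; rewrite uniform_mixingE big1 ?mule0 ?ltxx// => i _.
by rewrite diracE memNset//= => -[]; rewrite in_itv/=.
Qed.

Lemma uniform_mixture_density (smin smax mu x : R) :
  0 < smin -> (forall i, smin <= sigma i <= smax) ->
  mixture_density mu uniform_mixing x =
  n%:R^-1 * \sum_(i < n) gauss_kernel (sigma i) (x - mu).
Proof.
move=> smin0 sb; apply: EFin_inj.
rewrite (mixture_integral smin0 (uniform_mixing_support sb)).
rewrite integral_uniform_mixing//.
- by rewrite EFinM -sumEFin.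
- by apply/measurable_EFinP; exact: measurable_gauss_kernel.
- move=> s /=; rewrite in_itv/= => /andP[s1 _].
  by rewrite lee_fin ltW// gauss_kernel_gt0//; exact: lt_le_trans s1.
Qed.

Lemma mass_uniform_mixture (smin smax a : R) (A : set TR) :
  0 < smin -> (forall i, smin <= sigma i <= smax) -> measurable A ->
  mass (mixture_density a uniform_mixing) A =
  n%:R^-1 * \sum_(i < n) mass (fun x => gauss_kernel (sigma i) (x - a)) A.
Proof.
move=> smin0 sb mA.
have s12 : smin <= smax.
  by have /andP[/le_trans] := sb (Ordinal n0); apply.
have s0 i : 0 < sigma i by have /andP[/(lt_le_trans smin0)] := sb i.
have dk i := density_gauss_kernel a (s0 i).
have dm := density_mixture a smin0 s12 (uniform_mixing_support sb).
have mk i : measurable_fun A (fun x => (gauss_kernel (sigma i) (x - a))%:E).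
  by have [mk _ _] := dk i; exact/measurable_EFinP/measurable_funTS.
have k0 i x : A x -> (0 <= (gauss_kernel (sigma i) (x - a))%:E)%E.
  by have [_ k0 _] := dk i; rewrite lee_fin.
apply: EFin_inj; rewrite massE// EFinM -sumEFin.
rewrite (eq_bigr _ (fun i _ => massE (dk i) mA)).
rewrite -ge0_integral_sum// -ge0_integralZl_EFin//; last 2 first.
- by move=> x Ax; apply: sume_ge0 => i _; exact: k0.
- exact: emeasurable_sum.
apply: eq_integral => x _; rewrite (uniform_mixture_density _ _ smin0 sb).
by rewrite EFinM -sumEFin.
Qed.

(** The components that are not signals contribute a nonnegative term. *)
Lemma uniform_mixture_gap (smin smax a b : R) (m : nat) :
  0 < smin -> (forall i, smin <= sigma i <= smax) ->
  (m <= #|[set i : 'I_n | (sigma i <= 1)%R]%SET|)%N -> a < b ->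
  m%:R / n%:R * (signal_const R * (1 - expR (- (b - a)))) <=
  mass (mixture_density a uniform_mixing) `[a - 1, a] -
  mass (mixture_density a uniform_mixing) `[2 * b - a, 2 * b - a + 1].
Proof.
move=> smin0 sb mS ab.
have s0 i : 0 < sigma i by have /andP[/(lt_le_trans smin0)] := sb i.
rewrite !(mass_uniform_mixture _ smin0 sb); try exact: measurable_itv.
rewrite -mulrBr -sumrB [m%:R / _]mulrC -mulrA ler_pM2l ?invr_gt0 ?ltr0n//.
apply: le_trans (ler_sum _ (fun i _ => gauss_kernel_gap ab (s0 i))).
rewrite -big_mkcond/= sumr_const -[leRHS]mulr_natl.
have -> : #|[pred i | sigma i <= 1]| = #|[set i : 'I_n | (sigma i <= 1)%R]%SET|.
  by apply: eq_card => i; rewrite !inE.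
rewrite ler_wpM2r ?ler_nat// mulr_ge0 ?(ltW (signal_const_gt0 R))//.
by rewrite subr_ge0 expR_le1; lra.
Qed.

End uniform_mixing.

(** * Truncation of the exponential series *)

Section exponential_series.
Variable R : realType.
Implicit Types (v t : R).

Lemma expR_partial_sum_le v (K : nat) : 0 <= v ->
  \sum_(k < K) v ^+ k / k`!%:R <= expR v.
Proof.
move=> v0.
have -> : \sum_(k < K) v ^+ k / k`!%:R = series (exp_coeff v) K.
  by rewrite /series/= big_mkord.
apply: nondecreasing_cvgn_le; last exact: is_cvg_series_exp_coeff.
apply/nondecreasing_seqP => k; rewrite !seriesEnat/= big_nat_recr//= lerDl.
exact: exp_coeff_ge0.
Qed.

(** Each term of the tail of the series at [t * v] is at most [t ^+ K] times
    the corresponding term at [v]. *)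
Lemma expR_tail_le v t (K : nat) : 0 <= v -> 0 <= t <= 1 ->
  expR (t * v) <= \sum_(k < K) (t * v) ^+ k / k`!%:R + t ^+ K * expR v.
Proof.
move=> v0 /andP[t0 t1].
apply: limr_le; first exact: is_cvg_series_exp_coeff.
apply: nearW => N; rewrite seriesEnat/= big_mkord.
have tv k : 0 <= (t * v) ^+ k / k`!%:R by rewrite divr_ge0// exprn_ge0// mulr_ge0.
have [NK|KN] := leqP N K.
  rewrite -[leLHS]addr0; apply: lerD; last first.
    by rewrite mulr_ge0 ?exprn_ge0 ?expR_ge0.
  rewrite (big_ord_widen _ (fun k => (t * v) ^+ k / k`!%:R) NK).
  by rewrite big_mkcond; apply: ler_sum => i _; case: ifP.
rewrite -(subnKC (ltnW KN)) big_split_ord/= lerD2l.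
apply: (@le_trans _ _ (t ^+ K * \sum_(i < N - K) v ^+ (K + i) / (K + i)`!%:R)).
  rewrite mulr_sumr; apply: ler_sum => i _.
  rewrite /exp_coeff/= exprMn [t ^+ (K + _)]exprD -!mulrA ler_wpM2l ?exprn_ge0//.
  by rewrite ler_piMl ?exprn_ile1// divr_ge0// exprn_ge0.
rewrite ler_wpM2l ?exprn_ge0//.
apply: le_trans (expR_partial_sum_le N v0).
rewrite -[in leRHS](subnKC (ltnW KN)) big_split_ord/= lerDr.
by apply: sumr_ge0 => i _; rewrite divr_ge0// exprn_ge0.
Qed.

(** The derivative of [expR (- a ^+ 2 / 2)] is bounded because
    [`|a| <= expR (a ^+ 2 / 2)]. *)
Lemma expR_gauss_lipschitz (a b : R) :
  expR (- a ^+ 2 / 2) <= expR (- b ^+ 2 / 2) + 2 * `|a - b|.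
Proof.
set d := `|a - b|; have d0 : 0 <= d by exact: normr_ge0.
have e1 : expR (- a ^+ 2 / 2) <= 1.
  by rewrite expR_le1; have := sqr_ge0 a; lra.
have e0 := expR_ge0 (- a ^+ 2 / 2).
have [d1|d1] := lerP 1 d.
  by rewrite (le_trans e1)//; have := expR_ge0 (- b ^+ 2 / 2); lra.
have ea : expR (- a ^+ 2 / 2) * `|a| <= 1.
  have /(ler_wpM2l e0) : `|a| <= expR (a ^+ 2 / 2).
    apply: le_trans (expR_ge1Dx _).
    by rewrite -real_normK ?num_real//; have := sqr_ge0 (`|a| - 1); nra.
  by rewrite -expRD -mulrDl addNr mul0r expR0.
have -> : - b ^+ 2 / 2 = - a ^+ 2 / 2 + (a ^+ 2 - b ^+ 2) / 2 by ring.
rewrite expRD.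
have h : 1 - (2 * `|a| * d + d ^+ 2) / 2 <= expR ((a ^+ 2 - b ^+ 2) / 2).
  apply: le_trans (expR_ge1Dx _).
  have bd : b ^+ 2 <= (`|a| + d) ^+ 2.
    rewrite -[leLHS]real_normK ?num_real// ler_sqr ?nnegrE ?addr_ge0//.
    rewrite -[b](subKr a) (le_trans (ler_normB _ _))//.
  by rewrite -(@real_normK _ a) ?num_real//; nra.
have huw := ler_wpM2l e0 h.
clearbody d; clear h.
move: (expR (- a ^+ 2 / 2)) e0 e1 ea huw => u u0 u1 ua.
move: (expR _) => w huw.
have h1 : 0 <= d * (1 - u * `|a|) by rewrite mulr_ge0//; lra.
have h2 : 0 <= d * (1 - u) by rewrite mulr_ge0//; lra.
have h3 : 0 <= u * (d * (1 - d)) by rewrite mulr_ge0// mulr_ge0//; lra.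
nra.
Qed.

End exponential_series.

(** * A finite cover of the scale mixtures *)

Section cover.
Variables (R : realType) (smin smax : R) (J K Z : nat).
Hypotheses (smin0 : 0 < smin) (sminmax : smin <= smax).
Hypothesis smaxJ : smax < smin * 2 ^+ J.
Hypothesis Z0 : (0 < Z)%N.
Local Notation TR := (measurableTypeR R).
Local Notation D := (`[smin, smax]%classic : set TR).

Definition scale (j : nat) : R := smin * 2 ^+ j.

Lemma scale_gt0 j : 0 < scale j.
Proof. by rewrite mulr_gt0// exprn_gt0. Qed.

Lemma scale_ge j : smin <= scale j.
Proof. by rewrite ler_peMr ?(ltW smin0)// exprn_ege1// ler1n. Qed.

Definition in_block (j : nat) (s : R) := scale j <= s < scale j.+1.

Lemma block_uniq j j' s : in_block j s -> in_block j' s -> j = j'.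
Proof.
move=> /andP[a1 a2] /andP[b1 b2].
have le k k' : scale k <= s -> s < scale k'.+1 -> (k <= k')%N.
  move=> h1 h2; rewrite -ltnS -(ltr_eXn2l (x := 2 : R)) ?ltr1n//.
  by rewrite -(ltr_pM2l smin0); exact: le_lt_trans h2.
by apply/eqP; rewrite eqn_leq !le.
Qed.

Lemma block_exists s : smin <= s <= smax -> exists j : 'I_J, in_block j s.
Proof.
move=> /andP[s1 s2].
have sJ : s < scale J by exact: le_lt_trans smaxJ.
have ex : exists j, s < scale j by exists J.
have := ex_minnP ex; case=> -[|j] sj jmin.
  by move: sj; rewrite /scale expr0 mulr1 ltNge s1.
have jJ : (j < J)%N by exact: jmin.
exists (Ordinal jJ); rewrite /in_block sj andbT leNgt; apply/negP => /jmin.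
by rewrite ltnn.
Qed.

(** With [q] for [scale j / s], of order [1] on the block, the kernel is
    [gauss_const R / scale j * expR (- v) * q * expR ((1 - q ^+ 2) * v)] where
    [v] only depends on the block and on the point; the two functions below are
    the terms of the exponential series in [1 - q ^+ 2], which is at most
    [3 / 4], split into the scale and the point. *)
Definition block_moment_fun (j k : nat) (s : R) : R :=
  if in_block j s then scale j / s * (1 - (scale j / s) ^+ 2) ^+ k else 0.

Definition block_coef (j k : nat) (y : R) : R :=
  gauss_const R / scale j * expR (- ((y / scale j) ^+ 2 / 2)) *
  (((y / scale j) ^+ 2 / 2) ^+ k / k`!%:R).

Lemma block_coef_ge0 j k y : 0 <= block_coef j k y.
Proof.
by rewrite /block_coef !mulr_ge0 ?expR_ge0 ?invr_ge0 ?exprn_ge0// ?divr_ge0 ?sqr_ge0//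
  ltW ?gauss_const_gt0 ?scale_gt0.
Qed.

Lemma sum_block_coef_le j y : \sum_(k < K) block_coef j k y <= smin^-1.
Proof.
rewrite /block_coef -mulr_sumr.
set v := (y / scale j) ^+ 2 / 2.
have v0 : 0 <= v by rewrite divr_ge0 ?sqr_ge0.
have c0 := ltW (gauss_const_gt0 R); have s0 := scale_gt0 j.
apply: (@le_trans _ _ (gauss_const R / scale j * expR (- v) * expR v)).
  rewrite ler_wpM2l ?expR_partial_sum_le// mulr_ge0 ?expR_ge0//.
  by rewrite divr_ge0// ltW.
rewrite -mulrA -expRD addNr expR0 mulr1.
apply: (@le_trans _ _ (1 / scale j)).
  by rewrite ler_pM2r ?invr_gt0// gauss_const_le1.
by rewrite mul1r lef_pV2 ?posrE// scale_ge.
Qed.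

Lemma block_moment_fun_ge0_le1 j k s : 0 <= block_moment_fun j k s <= 1.
Proof.
rewrite /block_moment_fun; case: ifPn => [/andP[a b]|_]; last by rewrite lexx ler01.
have s0 : 0 < s by exact: lt_le_trans (scale_gt0 j) a.
have r0 : 0 <= scale j / s by rewrite divr_ge0 ?ltW ?scale_gt0.
have r1 : scale j / s <= 1 by rewrite ler_pdivrMr// mul1r.
have t0 : 0 <= 1 - (scale j / s) ^+ 2 by rewrite subr_ge0 exprn_ile1.
have t1 : 1 - (scale j / s) ^+ 2 <= 1 by rewrite gerBl sqr_ge0.
rewrite mulr_ge0 ?exprn_ge0//=.
by rewrite mulr_ile1 ?exprn_ge0 ?exprn_ile1.
Qed.

Lemma measurable_block_moment_fun j k :
  measurable_fun setT (block_moment_fun j k).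
Proof.
have mr : measurable_fun setT (fun s : R => scale j / s).
  by apply: measurable_funM => //; exact: measurable_invr.
apply: measurable_fun_ifT.
- by apply: measurable_and; [exact: measurable_fun_ler|exact: measurable_fun_ltr].
- apply: measurable_funM => //; apply: measurable_funX.
  by apply: measurable_funB => //; exact: measurable_funX.
- exact: measurable_cst.
Qed.

Definition kernel_trunc (y s : R) : R :=
  \sum_(j < J) \sum_(k < K) block_coef j k y * block_moment_fun j k s.

(** The convergence is geometric and uniform in [y], although the exponent is
    unbounded: the factor [expR (- v)] absorbs the tail of the series. *)
Lemma kernel_trunc_bounds y s : smin <= s <= smax ->
  kernel_trunc y s <= gauss_kernel s y <=
  kernel_trunc y s + (3 / 4) ^+ K / smin.
Proof.
move=> ss; have [j js] := block_exists ss.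
have -> : kernel_trunc y s =
    \sum_(k < K) block_coef j k y * block_moment_fun j k s.
  rewrite /kernel_trunc (bigD1 j)//= [X in _ + X]big1 ?addr0// => i ij.
  rewrite big1// => k _; rewrite /block_moment_fun; case: ifP => iss; last by rewrite mulr0.
  by move: ij; rewrite (_ : i = j) ?eqxx//; apply: val_inj; exact: block_uniq iss js.
rewrite /block_moment_fun js; move: js => /andP[].
have := scale_ge j; have := scale_gt0 j; rewrite /block_coef.
have -> : scale j.+1 = 2 * scale j by rewrite /scale exprS mulrCA.
move: (scale j) => a a0 aS a1 a2; have s0 : 0 < s by exact: lt_le_trans a1.
pose v := (y / a) ^+ 2 / 2; pose q := a / s; pose t := 1 - q ^+ 2.
have v0 : 0 <= v by rewrite divr_ge0 ?sqr_ge0.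
have q0 : 0 <= q by rewrite divr_ge0 ?ltW.
have q1 : q <= 1 by rewrite ler_pdivrMr// mul1r.
have q2 : 2^-1 <= q by rewrite ler_pdivlMr// mulrC ler_pdivrMr// mulrC ltW.
have t0 : 0 <= t by rewrite subr_ge0 exprn_ile1.
have t34 : t <= 3 / 4.
  have h : 0 <= 2^-1 :> R by lra.
  by rewrite /t expr2; have := ler_pM h h q2 q2; lra.
pose A := gauss_const R / a * expR (- v) * q.
have A0 : 0 <= A.
  by rewrite !mulr_ge0 ?expR_ge0 ?invr_ge0// ltW// gauss_const_gt0.
have -> : gauss_kernel s y = A * expR (t * v).
  have e : - (y / s) ^+ 2 / 2 = - v + t * v.
    by rewrite /t /v /q; field; rewrite !gt_eqF.
  by rewrite gauss_kernelE e expRD /A /q; field; rewrite !gt_eqF.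
have -> : \sum_(k < K) gauss_const R / a * expR (- ((y / a) ^+ 2 / 2)) *
    (((y / a) ^+ 2 / 2) ^+ k / k`!%:R) * (a / s * (1 - (a / s) ^+ 2) ^+ k) =
    A * \sum_(k < K) (t * v) ^+ k / k`!%:R.
  rewrite mulr_sumr; apply: eq_bigr => k _.
  by rewrite [(t * v) ^+ k]exprMn /A -/v -/q -/t; ring.
have tv0 : 0 <= t * v by rewrite mulr_ge0.
rewrite ler_wpM2l//= ?expR_partial_sum_le//.
have t1 : 0 <= t <= 1 by rewrite t0/= /t gerBl sqr_ge0.
apply: le_trans (ler_wpM2l A0 (expR_tail_le K v0 t1)) _.
rewrite mulrDr lerD2l.
have -> : A * (t ^+ K * expR v) = gauss_const R * q * (t ^+ K * a^-1).
  by rewrite /A expRN; field; rewrite ?(gt_eqF (expR_gt0 v)) ?(gt_eqF a0) ?(gt_eqF s0).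
rewrite -[leRHS]mul1r ler_pM//.
- by rewrite mulr_ge0// ltW// gauss_const_gt0.
- by rewrite mulr_ge0 ?exprn_ge0// invr_ge0 ltW.
- by rewrite mulr_ile1// ?gauss_const_le1// ltW// gauss_const_gt0.
rewrite ler_pM ?exprn_ge0// ?invr_ge0 ?(ltW a0)//.
  by rewrite lerXn2r// nnegrE divr_ge0.
by rewrite lef_pV2.
Qed.

Definition block_moment (G : probability TR R) (j k : nat) : R :=
  fine (\int[G]_(s in D) (block_moment_fun j k s)%:E)%E.

Section moments.
Variable G : probability TR R.
Hypothesis GD : msupport G `<=` D.

Let mD : measurable D. Proof. exact: measurable_itv. Qed.

Let mpsi j k : measurable_fun D (fun s => (block_moment_fun j k s)%:E).
Proof.
by apply/measurable_EFinP; apply: measurable_funTS; exact: measurable_block_moment_fun.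
Qed.

Let psi0 j k s : (0 <= (block_moment_fun j k s)%:E)%E.
Proof. by have /andP[] := block_moment_fun_ge0_le1 j k s. Qed.

Lemma block_moment_integral_le1 j k :
  (\int[G]_(s in D) (block_moment_fun j k s)%:E <= 1)%E.
Proof.
rewrite -((integral_cst_support GD) 1); apply: ge0_le_integral => // s _.
by rewrite lee_fin; have /andP[] := block_moment_fun_ge0_le1 j k s.
Qed.

Lemma block_momentE j k :
  ((block_moment G j k)%:E = \int[G]_(s in D) (block_moment_fun j k s)%:E)%E.
Proof.
rewrite fineK// ge0_fin_numE; last exact: integral_ge0.
by apply: le_lt_trans (block_moment_integral_le1 j k) _; rewrite ltry.
Qed.

Lemma block_moment_ge0 j k : 0 <= block_moment G j k.
Proof. by rewrite -lee_fin block_momentE integral_ge0. Qed.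

Lemma block_moment_le1 j k : block_moment G j k <= 1.
Proof. by rewrite -lee_fin block_momentE block_moment_integral_le1. Qed.

Definition mixture_trunc (y : R) : R :=
  \sum_(j < J) \sum_(k < K) block_coef j k y * block_moment G j k.

Lemma integral_kernel_trunc y :
  (\int[G]_(s in D) (kernel_trunc y s)%:E = (mixture_trunc y)%:E)%E.
Proof.
rewrite /kernel_trunc /mixture_trunc.
under eq_integral do rewrite -sumEFin.
have m1 (j k : nat) : measurable_fun D
    (fun s => (block_coef j k y * block_moment_fun j k s)%:E).
  apply/measurable_EFinP; apply: measurable_funM => //.
  by apply: measurable_funTS; exact: measurable_block_moment_fun.
have p1 (j k : nat) s : (0 <= (block_coef j k y * block_moment_fun j k s)%:E)%E.
  by rewrite lee_fin mulr_ge0 ?block_coef_ge0//; exact: psi0.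
rewrite ge0_integral_sum//; last 2 first.
- move=> j; apply/measurable_EFinP; apply: measurable_sum => k.
  by have /measurable_EFinP := m1 j k.
- by move=> j s _; rewrite -sumEFin; apply: sume_ge0.
rewrite -sumEFin; apply: eq_bigr => j _.
under eq_integral do rewrite -sumEFin.
rewrite ge0_integral_sum// -sumEFin; apply: eq_bigr => k _.
under eq_integral do rewrite EFinM.
rewrite [RHS]EFinM block_momentE ge0_integralZl_EFin//.
exact: block_coef_ge0.
Qed.

Let measurable_kernel_trunc y : measurable_fun setT (kernel_trunc y).
Proof.
apply: measurable_sum => j; apply: measurable_sum => k.
by apply: measurable_funM => //; exact: measurable_block_moment_fun.
Qed.

Lemma mixture_trunc_bounds mu x :
  mixture_trunc (x - mu) <= mixture_density mu G x <=
  mixture_trunc (x - mu) + (3 / 4) ^+ K / smin.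
Proof.
have t0 s : 0 <= kernel_trunc (x - mu) s.
  apply: sumr_ge0 => j _; apply: sumr_ge0 => k _.
  by rewrite mulr_ge0 ?block_coef_ge0//; exact: psi0.
apply/andP; split; rewrite -lee_fin.
  rewrite -integral_kernel_trunc; apply: (mixture_integral_ge smin0 GD) => //.
  by move=> s /(kernel_trunc_bounds (x - mu)) /andP[-> _]; rewrite t0.
rewrite EFinD -integral_kernel_trunc -[X in (_ + X)%E](integral_cst_support GD).
rewrite -ge0_integralD//; last 3 first.
- by move=> s _; rewrite lee_fin.
- by apply/measurable_EFinP; apply: measurable_funTS; exact: measurable_kernel_trunc.
- by move=> s _; rewrite lee_fin divr_ge0 ?exprn_ge0 ?divr_ge0// ltW.
under eq_integral do rewrite -EFinD.
apply: (mixture_integral_le smin0 GD); first exact: measurable_funD.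
by move=> s /(kernel_trunc_bounds (x - mu)) /andP[_].
Qed.

End moments.

Lemma gauss_kernel_lipschitz s y z : smin <= s ->
  gauss_kernel s y <= gauss_kernel s z + 2 * `|y - z| / smin ^+ 2.
Proof.
move=> ss; have s0 : 0 < s by exact: lt_le_trans ss.
have c0 := ltW (gauss_const_gt0 R).
rewrite !gauss_kernelE.
apply: (@le_trans _ _ (gauss_const R * (s^-1 *
   (expR (- (z / s) ^+ 2 / 2) + 2 * `|y / s - z / s|)))).
  by rewrite ler_wpM2l// ler_wpM2l ?invr_ge0 ?(ltW s0)// expR_gauss_lipschitz.
rewrite mulrDr mulrDr lerD2l -mulrBl normrM [`|s^-1|]gtr0_norm ?invr_gt0//.
have -> : gauss_const R * (s^-1 * (2 * (`|y - z| / s))) =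
  gauss_const R * (2 * `|y - z|) * (s ^+ 2)^-1 by field; rewrite gt_eqF.
apply: ler_pM.
- by rewrite !mulr_ge0.
- by rewrite invr_ge0 sqr_ge0.
- by rewrite ler_piMl ?mulr_ge0// gauss_const_le1.
- by rewrite lef_pV2 ?posrE ?exprn_gt0// ler_sqr// nnegrE ltW.
Qed.

Lemma mixture_density_lipschitz G mu nu x : msupport G `<=` D ->
  mixture_density mu G x <=
  mixture_density nu G x + 2 * `|mu - nu| / smin ^+ 2.
Proof.
move=> GD; have mD : measurable D by exact: measurable_itv.
have c0 : 0 <= 2 * `|mu - nu| / smin ^+ 2 by rewrite !mulr_ge0// invr_ge0 sqr_ge0.
have mk : measurable_fun setT (fun s : R => gauss_kernel s (x - nu)).
  exact: measurable_gauss_kernel.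
rewrite -lee_fin EFinD (mixture_integral smin0 GD nu x).
have <- : (\int[G]_(s in D) (2 * `|mu - nu| / smin ^+ 2)%:E =
    (2 * `|mu - nu| / smin ^+ 2)%:E)%E by exact: integral_cst_support.
rewrite -ge0_integralD//; last 2 first.
- move=> s; rewrite /= in_itv/= => /andP[s1 _].
  by rewrite lee_fin ltW// gauss_kernel_gt0//; exact: lt_le_trans s1.
- by apply/measurable_EFinP; exact: measurable_funTS.
under eq_integral do rewrite -EFinD.
apply: (mixture_integral_le smin0 GD); first exact: measurable_funD.
move=> s /andP[s1 _].
have -> : `|mu - nu| = `|x - mu - (x - nu)|.
  by rewrite -normrN; congr `|_|; ring.
exact: gauss_kernel_lipschitz.
Qed.

(** By [mixture_trunc_bounds] a mixture is determined up to a small error by its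
    location and its block moments; a cell consists of their roundings. *)
Definition cell (N : nat) : finType :=
  ('I_N.+1 * {ffun 'I_J * 'I_K -> 'I_Z.+1})%type.

Definition mixture_cell (N : nat) (lo step mu : R) (G : probability TR R) :
    cell N :=
  (inord (Num.truncn ((mu - lo) / step)),
   [ffun jk : 'I_J * 'I_K => inord (Num.truncn (Z%:R * block_moment G jk.1 jk.2))]).

Lemma card_cell N : #|cell N| = (N.+1 * Z.+1 ^ (J * K))%N.
Proof. by rewrite card_prod card_ord card_ffun card_prod !card_ord. Qed.

Let truncn_inord_dist (N : nat) (a b : R) : 0 <= a < N.+1%:R -> 0 <= b < N.+1%:R ->
  inord (Num.truncn a) = inord (Num.truncn b) :> 'I_N.+1 -> `|a - b| <= 1.
Proof.
move=> /andP[a0 aN] /andP[b0 bN] /(congr1 (@nat_of_ord _)).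
rewrite !inordK ?truncn_lt_nat// => e.
have := truncn_itv a0; have := truncn_itv b0; rewrite e -natr1.
by move=> /andP[? ?] /andP[? ?]; rewrite ler_norml; apply/andP; split; lra.
Qed.

(** The sum over [k] of the coefficients of a block is at most [smin^-1], so that
    the rounding errors of the moments add up over the blocks only. *)
Lemma mixture_cover (N : nat) (lo step mu nu : R) (G G' : probability TR R) :
  0 < step -> msupport G `<=` D -> msupport G' `<=` D ->
  0 <= (mu - lo) / step < N.+1%:R -> 0 <= (nu - lo) / step < N.+1%:R ->
  mixture_cell N lo step mu G = mixture_cell N lo step nu G' -> forall x,
  mixture_density mu G x <= mixture_density nu G' x +
    ((J%:R / Z%:R + (3 / 4) ^+ K) / smin + 2 * step / smin ^+ 2).
Proof.
move=> step0 GD GD' muN nuN [] /(truncn_inord_dist muN nuN) munu /ffunP mom x.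
have dmu : `|mu - nu| <= step.
  move: munu; rewrite -mulrBl (_ : mu - lo - (nu - lo) = mu - nu); last ring.
  by rewrite normrM [`|step^-1|]gtr0_norm ?invr_gt0// ler_pdivrMr// mul1r.
have Zr0 : 0 < Z%:R :> R by rewrite ltr0n.
have moment j k : (j < J)%N -> (k < K)%N ->
    block_moment G j k <= block_moment G' j k + Z%:R^-1.
  move=> jJ kK; have := mom (Ordinal jJ, Ordinal kK); rewrite !ffunE/=.
  have rng H : msupport H `<=` D -> 0 <= Z%:R * block_moment H j k < Z.+1%:R.
    move=> HD; rewrite mulr_ge0 ?ler0n ?block_moment_ge0//=.
    rewrite (@le_lt_trans _ _ (Z%:R * 1))// ?ler_wpM2l ?block_moment_le1//.
    by rewrite mulr1 ltr_nat.
  move=> /(truncn_inord_dist (rng _ GD) (rng _ GD')).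
  rewrite -mulrBr ler_norml => /andP[_]; rewrite -ler_pdivlMl// mulr1; lra.
have /andP[_ h1] := mixture_trunc_bounds GD mu x.
have h2 : mixture_density mu G' x <=
    mixture_density nu G' x + 2 * step / smin ^+ 2.
  apply: le_trans (mixture_density_lipschitz mu nu x GD') _.
  by rewrite lerD2l ler_wpM2r ?invr_ge0 ?sqr_ge0// ler_wpM2l.
have /andP[h3 _] := mixture_trunc_bounds GD' mu x.
have h4 : mixture_trunc G (x - mu) <=
    mixture_trunc G' (x - mu) + J%:R / Z%:R / smin.
  have -> : J%:R / Z%:R / smin = \sum_(j < J) smin^-1 * Z%:R^-1.
    by rewrite sumr_const card_ord -[RHS]mulr_natl mulrAC mulrA.
  rewrite /mixture_trunc -big_split/=; apply: ler_sum => j _.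
  apply: (@le_trans _ _ (\sum_(k < K) (block_coef j k (x - mu) *
      block_moment G' j k + block_coef j k (x - mu) * Z%:R^-1))).
    apply: ler_sum => k _; rewrite -mulrDr ler_wpM2l ?block_coef_ge0//.
    exact: moment.
  rewrite big_split/= lerD2l -mulr_suml ler_wpM2r ?invr_ge0 ?ler0n//.
  exact: sum_block_coef_le.
rewrite mulrDl; lra.
Qed.

End cover.

(** * Expectations of products of independent variables *)

Section weighted_laws.
Context d (T : measurableType d) (R : realType) (mu : {measure set T -> \bar R}).
Variables (h : T -> R) (Y : T -> R).
Hypotheses (h0 : forall w, 0 <= h w) (mh : measurable_fun setT h)
  (mY : measurable_fun setT Y).

Import HBNNSimple.

Lemma integral_mul_simple (s : {nnsfun R >-> R}) :
  let r := finmap.enum_fset (fset_set (s @` setT)) in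
  (\int[mu]_w (h w * s (Y w))%:E = \sum_(i < size r)
    (r`_i)%:E * \int[mu]_w (h w * \1_(s @^-1` [set r`_i]) (Y w))%:E)%E.
Proof.
move=> r.
have mB i : measurable (s @^-1` [set r`_i]) by exact: measurable_funPTI.
have r0 (i : 'I_(size r)) : 0 <= r`_i.
  have rE : (r`_i \in r) = (r`_i \in s @` setT) by exact: in_fset_set.
  by have := mem_nth 0 (ltn_ord i); rewrite -/r rE => /set_mem[x _ <-].
have mBY i : measurable_fun setT (fun w => \1_(s @^-1` [set r`_i]) (Y w) : R).
  by apply: (measurableT_comp (measurable_indic (mB i))).
under eq_integral do rewrite fimfunEord mulr_sumr -sumEFin.
rewrite ge0_integral_sum//.
- apply: eq_bigr => i _; rewrite -ge0_integralZl_EFin//; last 2 first.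
  + by move=> w _; rewrite lee_fin mulr_ge0.
  + by apply/measurable_EFinP; exact: measurable_funM.
  by apply: eq_integral => w _; rewrite -EFinM mulrCA.
- by move=> i; apply/measurable_EFinP; do 2 apply: measurable_funM => //.
- by move=> i w _; rewrite lee_fin !mulr_ge0// r0.
Qed.

Lemma integral_mul_comp_cvg (g : R -> R)
    (mg : measurable_fun setT (EFin \o g)) : (forall x, 0 <= g x) ->
  (\int[mu]_w (h w * nnsfun_approx measurableT mg k (Y w))%:E @[k --> \oo] -->
   \int[mu]_w (h w * g (Y w))%:E)%E.
Proof.
move=> g0; pose G := nnsfun_approx measurableT mg.
have Gcvg x : (EFin \o G^~ x) @ \oo --> (g x)%:E.
  by apply: (cvg_nnsfun_approx measurableT mg) => // y _; rewrite lee_fin.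
have -> : (\int[mu]_w (h w * g (Y w))%:E =
    \int[mu]_w limn (fun k => (h w * G k (Y w))%:E))%E.
  apply: eq_integral => w _; apply/esym/cvg_lim => //.
  under eq_fun do rewrite EFinM.
  by rewrite EFinM; apply: cvgeZl => //; exact: Gcvg.
apply: cvg_monotone_convergence => //.
- move=> k; apply/measurable_EFinP; apply: measurable_funM => //.
  exact: measurableT_comp.
- by move=> k w _; rewrite lee_fin mulr_ge0.
- move=> w _ k k' kk'; rewrite lee_fin ler_wpM2l//.
  exact/lefP/nd_nnsfun_approx.
Qed.

End weighted_laws.

Section weighted_laws_eq.
Import HBNNSimple.

(** Two weighted laws that agree on indicators agree on nonnegative functions,
    by linearity and monotone convergence. *)
Lemma integral_mul_comp_eq d d' (T : measurableType d) (T' : measurableType d')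
    (R : realType) (mu : {measure set T -> \bar R})
    (nu : {measure set T' -> \bar R}) (h Y : T -> R) (h' Y' : T' -> R)
    (g : R -> R) :
  (forall w, 0 <= h w) -> measurable_fun setT h -> measurable_fun setT Y ->
  (forall w, 0 <= h' w) -> measurable_fun setT h' -> measurable_fun setT Y' ->
  (forall B : set R, measurable B -> \int[mu]_w (h w * \1_B (Y w))%:E =
     \int[nu]_w (h' w * \1_B (Y' w))%:E)%E ->
  (forall x, 0 <= g x) -> measurable_fun setT g ->
  (\int[mu]_w (h w * g (Y w))%:E = \int[nu]_w (h' w * g (Y' w))%:E)%E.
Proof.
move=> h0 mh mY h0' mh' mY' hB g0 /measurable_EFinP mg.
have c1 := integral_mul_comp_cvg (mu := mu) h0 mh mY mg g0.
have c2 := integral_mul_comp_cvg (mu := nu) h0' mh' mY' mg g0.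
suff e : (fun k => \int[mu]_w (h w * nnsfun_approx measurableT mg k (Y w))%:E)%E
    = (fun k => \int[nu]_w (h' w * nnsfun_approx measurableT mg k (Y' w))%:E)%E.
  by move: c1; rewrite e => c1; exact: cvg_unique c1 c2.
apply/funext => k; rewrite (integral_mul_simple _ h0 mh mY).
rewrite (integral_mul_simple _ h0' mh' mY').
by apply: eq_bigr => i _; rewrite hB.
Qed.

End weighted_laws_eq.

Section independence.
Context d (T : measurableType d) (R : realType) (P : probability T R).

(** Independence is the case of indicator functions; these are replaced by the
    given functions one after the other.  The remaining factors weight the law
    of the variable whose function is replaced, and [integral_mul_comp_eq]
    applies to this weighted law. *)
Lemma indep_integral_prod n (X : 'I_n -> {RV P >-> R}) (g : 'I_n -> R -> R)
    (e : 'I_n -> R) :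
  independent_RVs P X -> (forall i x, 0 <= g i x) ->
  (forall i, measurable_fun setT (g i)) ->
  (forall i, \int[P]_w (g i (X i w))%:E = (e i)%:E)%E ->
  (\int[P]_w (\prod_(i < n) g i (X i w))%:E = (\prod_(i < n) e i)%:E)%E.
Proof.
move=> indX.
(* the first m functions are arbitrary, the other ones are indicators *)
suff main m : (m <= n)%N -> forall (g : 'I_n -> R -> R) (e : 'I_n -> R),
    (forall i : 'I_n, (m <= i)%N -> exists2 B, measurable B & g i = \1_B) ->
    (forall i x, 0 <= g i x) -> (forall i, measurable_fun setT (g i)) ->
    (forall i, \int[P]_w (g i (X i w))%:E = (e i)%:E)%E ->
    (\int[P]_w (\prod_(i < n) g i (X i w))%:E = (\prod_(i < n) e i)%:E)%E.
  by apply: main (leqnn n) _ _ _ => i; rewrite leqNgt ltn_ord.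
clear g e; elim: m => [_ g e gB g0 mg ge|m IH mn g e gB g0 mg ge].
  have /choice[B gBE] : forall i : 'I_n, exists B, measurable B /\ g i = \1_B.
    by move=> i; have [B mB gi] := gB i (leq0n _); exists B.
  have mB i : measurable (B i) by have [] := gBE i.
  have gE i : g i = \1_(B i) by have [] := gBE i.
  have eE i : P (X i @^-1` B i) = (e i)%:E.
    rewrite -ge gE; transitivity (\int[P]_w (\1_(X i @^-1` B i) w)%:E)%E => //.
    by rewrite integral_indic// ?setIT//; exact: measurable_funPTI.
  pose E := \bigcap_(i in [set` [set: 'I_n]%SET]) (X i @^-1` B i).
  have mE : measurable E.
    apply: fin_bigcap_measurable => // i _; exact: measurable_funPTI.
  transitivity (\int[P]_w (\1_E w)%:E)%E.
    apply: eq_integral => w _; congr EFin; rewrite indicE.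
    have [wE|wE] := boolP (w \in E).
      rewrite big1// => i _; rewrite gE indicE mem_set//.
      by move/set_mem: wE => /(_ i); apply; rewrite /= inE.
    have /existsNP[i /not_implyP[_ wi]] : ~ E w.
      by move=> h; move/negP: wE; apply; exact/mem_set.
    by rewrite (bigD1 i)//= gE indicE memNset// mul0r.
  rewrite integral_indic// setIT (big_morph EFin (@EFinM R) erefl).
  rewrite [LHS](indX [set: 'I_n]%SET B mB).
  by apply: eq_big => [i|i _]; [rewrite inE|exact: eE].
pose i0 := Ordinal mn.
pose h w := \prod_(i < n | i != i0) g i (X i w).
have h0 w : 0 <= h w by apply: prodr_ge0.
have mgX i : measurable_fun setT (fun w => g i (X i w)).
  exact: (measurableT_comp (mg i)).
have mh : measurable_fun setT h.
  rewrite /h; under eq_fun do rewrite -big_filter.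
  by apply: measurable_prod.
have e0 i : 0 <= e i.
  by rewrite -lee_fin -ge integral_ge0// => w _; rewrite lee_fin.
have c0 : 0 <= \prod_(i < n | i != i0) e i by apply: prodr_ge0.
have hB (B : set R) : measurable B -> (\int[P]_w (h w * \1_B (X i0 w))%:E =
    (\prod_(i < n | i != i0) e i)%:E * P (X i0 @^-1` B))%E.
  move=> mB.
  pose g' i := if i == i0 then \1_B else g i.
  pose e' i := if i == i0 then fine (P (X i0 @^-1` B)) else e i.
  have PE : (fine (P (X i0 @^-1` B)))%:E = P (X i0 @^-1` B).
    by rewrite fineK// fin_num_measure//; exact: measurable_funPTI.
  have := IH (ltnW mn) g' e'.
  under eq_integral do rewrite (bigD1 i0)//= /g' eqxx mulrC.
  rewrite [in X in _ -> _ -> _ -> _ -> _ = X](bigD1 i0)//= /e' eqxx EFinM muleC PE.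
  under eq_integral => w _.
    rewrite (eq_bigr (fun i => g i (X i w))); last by move=> i /negbTE ->.
    over.
  rewrite (eq_bigr e); last by move=> i /negbTE ->.
  apply.
  - move=> i; rewrite /g'; have [_ _|ii mi] := eqVneq i i0; first by exists B.
    by apply: gB; rewrite ltn_neqAle mi andbT; apply: contra ii => /eqP h'; apply/eqP/val_inj.
  - by move=> i x; rewrite /g'; case: ifP.
  - by move=> i; rewrite /g'; case: ifP => // _; exact: measurable_indic.
  - move=> i; rewrite /g'; case: eqP => // ->; rewrite PE.
    transitivity (\int[P]_w (\1_(X i0 @^-1` B) w)%:E)%E => //.
    by rewrite integral_indic// ?setIT//; exact: measurable_funPTI.
under eq_integral do rewrite (bigD1 i0)//= mulrC.
have := @integral_mul_comp_eq _ _ _ _ R P P h (X i0)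
  (fun=> \prod_(i < n | i != i0) e i) (X i0) (g i0) h0 mh.
move=> -> //; last first.
  move=> B mB; rewrite hB//; under eq_integral do rewrite EFinM.
  rewrite ge0_integralZl_EFin//; last first.
    by apply/measurable_EFinP; exact: (measurableT_comp (measurable_indic mB)).
  congr (_ * _)%E.
  transitivity (\int[P]_w (\1_(X i0 @^-1` B) w)%:E)%E => //.
  by rewrite integral_indic// ?setIT//; exact: measurable_funPTI.
under eq_integral do rewrite EFinM.
rewrite ge0_integralZl_EFin//; last 2 first.
- by move=> w _; rewrite lee_fin.
- exact/measurable_EFinP.
by rewrite ge -EFinM [in RHS](bigD1 i0)//= mulrC.
Qed.

Lemma integral_normal_law (X : {RV P >-> R}) (m s : R) (g : R -> R) :
  0 < s -> has_normal_law P X m s -> (forall x, 0 <= g x) ->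
  measurable_fun setT g ->
  (\int[P]_w (g (X w))%:E =
   \int[lebesgue_measure]_x (gauss_kernel s (x - m) * g x)%:E)%E.
Proof.
move=> s0 nX g0 mg.
have mk : measurable_fun setT (fun x : R => gauss_kernel s (x - m)).
  by apply: measurable_gauss_kernel => //; exact: measurable_funB.
transitivity (\int[P]_w (1 * g (X w))%:E)%E.
  by apply: eq_integral => w _; rewrite mul1r.
apply: (@integral_mul_comp_eq _ _ _ _ R P lebesgue_measure (fun=> 1) X
  (fun x => gauss_kernel s (x - m)) id g) => //.
  by move=> x; exact/ltW/gauss_kernel_gt0.
move=> B mB; under eq_integral do rewrite mul1r.
transitivity (P (X @^-1` B)).
  transitivity (\int[P]_w (\1_(X @^-1` B) w)%:E)%E => //.
  by rewrite integral_indic// ?setIT//; exact: measurable_funPTI.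
transitivity (normal_prob m s B); first by rewrite -nX.
transitivity (\int[lebesgue_measure]_(x in B) (normal_pdf m s x)%:E)%E => //.
rewrite [LHS]integral_mkcond; apply: eq_integral => x _.
rewrite patchE indicE normal_pdf_gauss_kernel//.
by case: ifP => _; rewrite ?mulr1 ?mulr0.
Qed.

End independence.

(** * Likelihood ratios against the average density *)

Section likelihood_ratio.
Context d (T : measurableType d) (R : realType) (P : probability T R).
Variables (n : nat) (smin smax mu : R) (sigma : 'I_n -> R)
  (X : 'I_n -> {RV P >-> R}).
Hypotheses (n0 : (0 < n)%N) (smin0 : 0 < smin)
  (sb : forall i, smin <= sigma i <= smax)
  (indX : independent_RVs P X)
  (nX : forall i, has_normal_law P (X i) mu (sigma i)).
Local Notation leb := (@lebesgue_measure R).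

Let s0 i : 0 < sigma i.
Proof. by have /andP[/(lt_le_trans smin0)] := sb i. Qed.

Let s12 : smin <= smax.
Proof. by have /andP[/le_trans] := sb (Ordinal n0); apply. Qed.

(** The average of the densities of the observations is itself a mixture of the
    class over which the likelihood is maximized. *)
Definition average_density : R -> R := mixture_density mu (uniform_mixing sigma).
Local Notation p := average_density.

Let GD : msupport (uniform_mixing sigma) `<=` `[smin, smax].
Proof. exact: uniform_mixing_support. Qed.

Lemma average_densityE x : p x = n%:R^-1 * \sum_(i < n) gauss_kernel (sigma i) (x - mu).
Proof. exact: (uniform_mixture_density n0 mu x smin0 sb). Qed.

Lemma density_average : density p.
Proof. exact: (density_mixture mu smin0 s12 GD). Qed.

Lemma average_density_gt0 x : 0 < p x.
Proof. exact: (mixture_density_gt0 smin0 s12 GD). Qed.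

(** The square root of the likelihood ratio is integrable against [p] with
    integral the affinity; [q + eta] dominates all the mixtures of the cell of
    [q], and the window keeps the integral of the constant [eta] finite. *)
Definition half_ratio (q : R -> R) (eta W x : R) : R :=
  Num.sqrt ((q x + eta) / p x) * \1_(`[mu - W, mu + W]%classic : set R) x.

Variables (q : R -> R) (eta W t : R).
Hypotheses (dq : density q) (eta0 : 0 <= eta) (W0 : 0 <= W) (t0 : 0 < t).
Local Notation g := (half_ratio q eta W).
Local Notation A := (`[mu - W, mu + W]%classic : set (measurableTypeR R)).

Lemma half_ratio_ge0 x : 0 <= g x.
Proof. by rewrite mulr_ge0 ?sqrtr_ge0. Qed.

Let mA : measurable A. Proof. exact: measurable_itv. Qed.

Lemma measurable_half_ratio : measurable_fun setT g.
Proof.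
have [mq q0 _] := dq; have [mp p0 _] := density_average.
apply: measurable_funM; last exact: (measurable_indic mA).
apply: measurable_sqrt_comp => [x|].
  by rewrite divr_ge0// addr_ge0.
apply: measurable_funM; first exact: measurable_funD.
exact: (measurableT_comp (@measurable_invr R)).
Qed.

(** The last term is the price of [eta], by the inequality
    [2 * u * z <= t * z ^+ 2 + u ^+ 2 / t] at [z = Num.sqrt eta] and
    [u = Num.sqrt p]. *)
Definition ratio_bound : R := affinity p q + (t * eta * (2 * W) + t^-1) / 2.

Let half_ratio_le x : p x * g x <=
  Num.sqrt (p x) * Num.sqrt (q x) + (t * eta / 2 * \1_A x + t^-1 / 2 * p x).
Proof.
have [_ q0 _] := dq; have pp := average_density_gt0 x.
rewrite /half_ratio; set u := Num.sqrt (p x); set v := Num.sqrt (q x).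
have u0 : 0 < u by rewrite sqrtr_gt0.
have v0 : 0 <= v by exact: sqrtr_ge0.
have pE : p x = u ^+ 2 by rewrite sqr_sqrtr// ltW.
rewrite indicE; case: (x \in _); last first.
  rewrite !mulr0 add0r addr_ge0 ?mulr_ge0 ?(ltW u0) ?(ltW pp)//.
  by rewrite invr_ge0 ltW.
rewrite !mulr1; set z := Num.sqrt eta.
have z0 : 0 <= z by exact: sqrtr_ge0.
have zE : eta = z ^+ 2 by rewrite sqr_sqrtr.
have -> : p x * Num.sqrt ((q x + eta) / p x) = u * Num.sqrt (q x + eta).
  rewrite sqrtrM ?addr_ge0// sqrtrV ?(ltW pp)// -/u pE; field; rewrite gt_eqF//.
have sq : Num.sqrt (q x + eta) <= v + z.
  rewrite -[leRHS]ger0_norm ?addr_ge0// -sqrtr_sqr ler_sqrt ?sqr_ge0//.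
  rewrite sqrrD sqr_sqrtr// -zE -addrA [v * z *+ 2 + _]addrC addrA lerDl.
  by rewrite mulrn_wge0// mulr_ge0.
apply: (@le_trans _ _ (u * (v + z))); first by rewrite ler_pM2l.
rewrite mulrDr lerD2l pE zE -subr_ge0.
have -> : t * z ^+ 2 / 2 + t^-1 / 2 * u ^+ 2 - u * z = (t * z - u) ^+ 2 / (2 * t).
  by field; rewrite gt_eqF.
by rewrite divr_ge0 ?sqr_ge0// mulr_ge0// ltW.
Qed.

Lemma half_ratio_integral_le :
  (\int[leb]_x (p x * g x)%:E <= ratio_bound%:E)%E.
Proof.
have [mq q0 _] := dq; have [mp p0 p1] := density_average.
have mg := measurable_half_ratio.
have tp : 0 <= t^-1 / 2 by rewrite divr_ge0// invr_ge0 ltW.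
have te : 0 <= t * eta / 2 by rewrite divr_ge0// mulr_ge0// ltW.
have m1 : measurable_fun setT (fun x => Num.sqrt (p x) * Num.sqrt (q x)).
  by apply: measurable_funM; exact: measurable_sqrt_comp.
have m2 : measurable_fun setT (fun x => t * eta / 2 * \1_A x).
  by apply: measurable_funM => //; exact: (measurable_indic mA).
have m3 : measurable_fun setT (fun x => t^-1 / 2 * p x) by exact: measurable_funM.
apply: (@le_trans _ _ (\int[leb]_x ((Num.sqrt (p x) * Num.sqrt (q x))%:E +
    ((t * eta / 2 * \1_A x)%:E + (t^-1 / 2 * p x)%:E)))%E).
  apply: ge0_le_integral => //.
  - by move=> x _; rewrite lee_fin mulr_ge0// half_ratio_ge0.
  - by apply/measurable_EFinP; exact: measurable_funM.
  - by do 2 (apply: emeasurable_funD; first exact/measurable_EFinP);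
      exact/measurable_EFinP.
  - by move=> x _; rewrite -!EFinD lee_fin half_ratio_le.
rewrite ge0_integralD//; first last.
- by apply: emeasurable_funD; exact/measurable_EFinP.
- by move=> x _; rewrite -EFinD lee_fin addr_ge0// mulr_ge0.
- exact/measurable_EFinP.
rewrite ge0_integralD//; first last.
- exact/measurable_EFinP.
- by move=> x _; rewrite lee_fin mulr_ge0.
- exact/measurable_EFinP.
- by move=> x _; rewrite lee_fin mulr_ge0.
rewrite -(affinityE density_average dq).
under [X in (_ + (X + _) <= _)%E]eq_integral do rewrite EFinM.
rewrite ge0_integralZl_EFin//; last first.
  by apply/measurable_EFinP; exact: (measurable_indic mA).
under [X in (_ + (_ + X) <= _)%E]eq_integral do rewrite EFinM.
rewrite ge0_integralZl_EFin//; last 2 first.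
- by move=> x _; rewrite lee_fin.
- exact/measurable_EFinP.
rewrite p1 integral_indic// setIT.
have lA : lebesgue_measure (`[mu - W, mu + W]%classic : set R) = (2 * W)%:E.
  rewrite lebesgue_measure_itv/= lte_fin; case: ltP => h.
    by rewrite -EFinB; congr EFin; lra.
  have W1 := W0; by rewrite (_ : 2 * W = 0)//; lra.
apply: (@le_trans _ _ ((affinity p q)%:E +
    ((t * eta / 2)%:E * (2 * W)%:E + (t^-1 / 2)%:E * 1))%E).
  rewrite le_eqVlt; apply/orP; left; apply/eqP; congr (_ + (_ * _ + _))%E.
  exact: lA.
rewrite mule1 -EFinM -!EFinD lee_fin /ratio_bound; lra.
Qed.

Lemma half_ratio_expectation : exists e : 'I_n -> R,
  [/\ forall i, (\int[P]_w (g (X i w))%:E = (e i)%:E)%E, forall i, 0 <= e i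
    & (\sum_(i < n) e i) / n%:R <= ratio_bound].
Proof.
have mg := measurable_half_ratio; have g0 := half_ratio_ge0.
have law i := integral_normal_law (s0 i) (nX i) g0 mg.
have k0 i x : 0 <= gauss_kernel (sigma i) (x - mu) by exact/ltW/gauss_kernel_gt0.
have mk i : measurable_fun setT
    (fun x : R => gauss_kernel (sigma i) (x - mu) * g x).
  apply: measurable_funM => //; apply: measurable_gauss_kernel => //.
  exact: measurable_funB.
have nr0 : 0 < n%:R :> R by rewrite ltr0n.
have E0 i : (0 <= \int[P]_w (g (X i w))%:E)%E.
  by apply: integral_ge0 => w _; rewrite lee_fin.
have S : (\sum_(i < n) \int[P]_w (g (X i w))%:E <= (n%:R * ratio_bound)%:E)%E.
  under eq_bigr do rewrite law.
  rewrite -ge0_integral_sum//; last 2 first.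
  - by move=> i; apply/measurable_EFinP; exact: mk.
  - by move=> i x _; rewrite lee_fin mulr_ge0.
  have -> : (\int[leb]_x (\sum_(i < n) (gauss_kernel (sigma i) (x - mu) * g x)%:E) =
      \int[leb]_x (n%:R%:E * (p x * g x)%:E))%E.
    apply: eq_integral => x _; rewrite sumEFin -EFinM average_densityE.
    by rewrite -mulr_suml !mulrA divff ?gt_eqF// mul1r.
  have [mp p0 _] := density_average.
  rewrite ge0_integralZl_EFin ?ler0n//; last 2 first.
  - by move=> x _; rewrite lee_fin mulr_ge0.
  - by apply/measurable_EFinP; exact: measurable_funM.
  by rewrite EFinM lee_pmul2l// half_ratio_integral_le.
have F i : (\int[P]_w (g (X i w))%:E)%E \is a fin_num.
  rewrite ge0_fin_numE//; apply: le_lt_trans (ltry (n%:R * ratio_bound)).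
  apply: le_trans S; rewrite (bigD1 i)//= leeDl//.
  by apply: sume_ge0 => j _.
exists (fun i => fine (\int[P]_w (g (X i w))%:E)%E); split.
- by move=> i; rewrite fineK.
- by move=> i; exact: fine_ge0.
rewrite ler_pdivrMr// mulrC -lee_fin -sumEFin.
by under eq_bigr do rewrite fineK//.
Qed.

Definition ratio_event : set T := [set w | 1 <= \prod_(i < n) g (X i w)].

Let mprod : measurable_fun setT (fun w => \prod_(i < n) g (X i w)).
Proof.
apply: measurable_prod => i _.
exact: (measurableT_comp measurable_half_ratio).
Qed.

Lemma measurable_ratio_event : measurable ratio_event.
Proof.
have -> : ratio_event = (fun w => \prod_(i < n) g (X i w)) @^-1` `[1, +oo[%classic.
  by apply/seteqP; split => w; rewrite /ratio_event /= in_itv/= andbT.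
by rewrite -[X in measurable X]setTI; apply: mprod => //; exact: measurable_itv.
Qed.

(** By Markov's inequality and independence, the probability is at most the
    product of the expectations; the inequality of arithmetic and geometric means
    replaces them by their average, which is an integral against [p]. *)
Lemma ratio_event_prob : (P ratio_event <= (ratio_bound ^+ n)%:E)%E.
Proof.
have [e [eE e0 eS]] := half_ratio_expectation.
have mR := measurable_ratio_event.
apply: (@le_trans _ _ (\int[P]_w (\prod_(i < n) g (X i w))%:E)%E).
  rewrite -[ratio_event]setIT -integral_indic//; apply: ge0_le_integral => //.
  - by apply/measurable_EFinP; exact: measurable_indic.
  - exact/measurable_EFinP.
  - move=> w _; rewrite lee_fin indicE.
    have [|_] := boolP (w \in ratio_event); first by move/set_mem.
    by apply: prodr_ge0 => i _; exact: half_ratio_ge0.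
rewrite (indep_integral_prod (g := fun=> g) indX (fun=> half_ratio_ge0)
  (fun=> measurable_half_ratio) eE).
rewrite lee_fin.
have := (leif_AGM (A := [pred i : 'I_n | true]) (E := e) (fun i _ => e0 i)).1.
rewrite cardT size_enum_ord => /le_trans; apply.
have S0 : 0 <= \sum_(i < n) e i by apply: sumr_ge0.
by rewrite lerXn2r// nnegrE ?divr_ge0// (le_trans _ eS)// divr_ge0.
Qed.

End likelihood_ratio.

(** * Properties of the maximizer and normal tails *)

Section maximizer.
Variables (R : realType) (smin smax : R).
Hypotheses (smin0 : 0 < smin) (sminmax : smin <= smax).
Local Notation D := (`[smin, smax]%classic : set (measurableTypeR R)).

Let smax0 : 0 < smax. Proof. exact: lt_le_trans sminmax. Qed.

(** The comparison of [mixture_density_anti] is strict: the gain is at least the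
    factor [expR c], the gain of the component of scale [smax]. *)
Lemma mixture_density_lt (G : probability (measurableTypeR R) R) (mu nu x : R) :
  msupport G `<=` D -> `|x - nu| < `|x - mu| ->
  mixture_density mu G x < mixture_density nu G x.
Proof.
move=> GD xlt.
have sq : (x - nu) ^+ 2 < (x - mu) ^+ 2.
  by rewrite -(real_normK (num_real (x - nu))) -(real_normK (num_real (x - mu)))
    ltr_sqr ?nnegrE.
pose c := ((x - mu) ^+ 2 - (x - nu) ^+ 2) / (2 * smax ^+ 2).
have c0 : 0 < c by rewrite divr_gt0 ?subr_gt0// mulr_gt0// exprn_gt0.
have f0 := mixture_density_gt0 smin0 sminmax GD mu x.
apply: (@lt_le_trans _ _ (expR c * mixture_density mu G x)).
  by rewrite ltr_pMl// expR_gt1.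
rewrite -ler_pdivlMl ?expR_gt0// -lee_fin.
rewrite EFinM (mixture_integral smin0 GD nu x) -ge0_integralZl_EFin//; first last.
- by apply/measurable_EFinP; exact: measurable_gauss_kernel.
- move=> s; rewrite /= in_itv/= => /andP[s1 _].
  by rewrite lee_fin ltW// gauss_kernel_gt0//; exact: lt_le_trans s1.
under eq_integral do rewrite -EFinM.
apply: (mixture_integral_le smin0 GD).
  by apply: measurable_funM => //; exact: measurable_gauss_kernel.
move=> s /andP[s1 s2]; have s0 : 0 < s by exact: lt_le_trans s1.
rewrite ler_pdivlMl ?expR_gt0// !gauss_kernelE mulrCA ler_pM2l ?gauss_const_gt0//.
rewrite mulrCA ler_pM2l ?invr_gt0// -expRD ler_expR.
rewrite -subr_ge0.
have -> : - ((x - nu) / s) ^+ 2 / 2 - (c + - ((x - mu) / s) ^+ 2 / 2) =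
   ((x - mu) ^+ 2 - (x - nu) ^+ 2) / 2 * ((s ^+ 2)^-1 - (smax ^+ 2)^-1).
  by rewrite /c; field; rewrite !gt_eqF.
rewrite mulr_ge0 ?divr_ge0 ?subr_ge0 ?(ltW sq)//.
by rewrite lef_pV2 ?posrE ?exprn_gt0// ler_sqr ?nnegrE// ltW.
Qed.

Variables (n : nat) (n0 : (0 < n)%N).

Lemma avg_loglik_lt (x : 'I_n -> R) mu nu G : msupport G `<=` D ->
  (forall i, `|x i - nu| < `|x i - mu|) ->
  avg_loglik x mu G < avg_loglik x nu G.
Proof.
move=> GD h; rewrite /avg_loglik ltr_pM2l ?invr_gt0 ?ltr0n//.
apply: ltr_sum; first by apply/hasP; exists (Ordinal n0); rewrite ?mem_index_enum.
move=> i _; rewrite ltr_ln ?posrE ?mixture_density_lt//;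
  exact: (mixture_density_gt0 smin0 sminmax GD).
Qed.

(** Moving the location to the nearest end of an interval that contains the
    sample increases every term of the likelihood. *)
Lemma EB_location_bound (x : 'I_n -> R) mu W muhat G :
  is_EB_maximizer smin smax x muhat G -> (forall i, `|x i - mu| <= W) ->
  `|muhat - mu| <= W.
Proof.
move=> [GD opt] xW; rewrite leNgt; apply/negP => far.
have W0 : 0 <= W by apply: le_trans (xW (Ordinal n0)).
pose nu := if mu <= muhat then mu + W else mu - W.
suff /(avg_loglik_lt GD) : forall i, `|x i - nu| < `|x i - muhat|.
  by rewrite ltNge opt.
move=> i; have := xW i; rewrite ler_norml => /andP[x1 x2].
rewrite /nu; case: (lerP mu muhat) => h in far *.
  by rewrite !ler0_norm; lra.
by rewrite !ger0_norm; lra.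
Qed.

(** The uniform mixing law on the [sigma i] is a competitor. *)
Lemma EB_likelihood_ge (x sigma : 'I_n -> R) mu muhat G :
  (forall i, smin <= sigma i <= smax) ->
  is_EB_maximizer smin smax x muhat G ->
  \prod_(i < n) mixture_density mu (uniform_mixing sigma) (x i) <=
  \prod_(i < n) mixture_density muhat G (x i).
Proof.
move=> sb [GD opt].
have GU := uniform_mixing_support n0 sb.
have := opt mu _ GU.
rewrite /avg_loglik ler_pM2l ?invr_gt0 ?ltr0n//.
have lnE nu H : msupport H `<=` D ->
    \prod_(i < n) mixture_density nu H (x i) =
    expR (\sum_(i < n) ln (mixture_density nu H (x i))).
  move=> HD; rewrite expR_sum; apply: eq_bigr => i _.
  by rewrite lnK// posrE (mixture_density_gt0 smin0 sminmax HD).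
by rewrite (lnE _ _ GU) (lnE _ _ GD) ler_expR.
Qed.

Lemma EB_ratio_event_mem (x sigma : 'I_n -> R) mu muhat G (q : R -> R)
    (eta W : R) :
  (forall i, smin <= sigma i <= smax) ->
  is_EB_maximizer smin smax x muhat G -> (forall i, `|x i - mu| <= W) ->
  (forall y, mixture_density muhat G y <= q y + eta) ->
  1 <= \prod_(i < n) half_ratio mu sigma q eta W (x i).
Proof.
move=> sb EB xW fq; have [GD _] := EB.
have GU := uniform_mixing_support n0 sb.
have p0 i := mixture_density_gt0 smin0 sminmax GU mu (x i).
have f0 i := mixture_density_gt0 smin0 sminmax GD muhat (x i).
pose p := mixture_density mu (uniform_mixing sigma).
pose a i := (q (x i) + eta) / p (x i).
have fa i : 0 <= mixture_density muhat G (x i) / p (x i) <= a i.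
  by rewrite divr_ge0 ?(ltW (f0 i)) ?(ltW (p0 i))//= ler_pM2r ?invr_gt0 ?fq ?p0.
have a1 : 1 <= \prod_(i < n) a i.
  apply: (@le_trans _ _ (\prod_(i < n) (mixture_density muhat G (x i) / p (x i)))).
    rewrite prodf_div ler_pdivlMr ?prodr_gt0// mul1r.
    exact: (EB_likelihood_ge mu sb EB).
  exact: ler_prod.
have -> : \prod_(i < n) half_ratio mu sigma q eta W (x i) =
    \prod_(i < n) Num.sqrt (a i).
  apply: eq_bigr => i _; rewrite /half_ratio indicE mem_set ?mulr1//=.
  by rewrite in_itv/= -ler_distl.
have b0 : 0 <= \prod_(i < n) Num.sqrt (a i).
  by apply: prodr_ge0 => i _; exact: sqrtr_ge0.
rewrite -(@expr_ge1 _ 2)//.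
rewrite -prodrXl (eq_bigr a)// => i _; rewrite sqr_sqrtr//.
by have /andP[/le_trans] := fa i; apply.
Qed.

End maximizer.

(** Beyond [W] the density of scale [s] is at most
    [2 * expR (- (3 / 8 * (W / s) ^+ 2))] times the density of scale [2 * s]. *)
Lemma normal_tail d (T : measurableType d) (R : realType) (P : probability T R)
    (X : {RV P >-> R}) (m s W : R) : 0 < s -> 0 <= W ->
  has_normal_law P X m s ->
  (P [set w | (W < `|X w - m|)%R] <= (2 * expR (- (3 / 8 * (W / s) ^+ 2)))%:E)%E.
Proof.
move=> s0 W0 nX.
pose A : set R := ~` `[m - W, m + W]%classic.
have mA : measurable A by apply: measurableC; exact: measurable_itv.
have -> : [set w | W < `|X w - m|] = X @^-1` A.
  apply/seteqP; split => w; rewrite /A /= in_itv/= ltNge ler_distl => /negP;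
    by rewrite ?negbK.
have mXA : measurable (X @^-1` A) by exact: measurable_funPTI.
have s20 : 0 < 2 * s by rewrite mulr_gt0.
have e0 := expR_ge0 (- (3 / 8 * (W / s) ^+ 2)).
have -> : P (X @^-1` A) = (\int[P]_w (\1_A (X w) : R)%:E)%E.
  transitivity (\int[P]_w (\1_(X @^-1` A) w)%:E)%E => //.
  by rewrite integral_indic// ?setIT.
rewrite (integral_normal_law s0 nX)//.
rewrite -[leRHS]mule1 -(integral_gauss_kernel m s20).
have mk (u : R) : measurable_fun setT (fun x : R => gauss_kernel u (x - m)).
  by apply: measurable_gauss_kernel => //; exact: measurable_funB.
rewrite -ge0_integralZl_EFin//; first last.
- by apply/measurable_EFinP; exact: mk.
- by move=> x _; rewrite lee_fin ltW// gauss_kernel_gt0.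
apply: ge0_le_integral => //.
- by move=> x _; rewrite lee_fin mulr_ge0// ltW// gauss_kernel_gt0.
- by apply/measurable_EFinP; apply: measurable_funM; [exact: mk|exact: measurable_indic].
- by apply: measurable_funeM; apply/measurable_EFinP; exact: mk.
move=> x _; rewrite -EFinM lee_fin indicE.
have [xA|_] := boolP (x \in A); last first.
  by rewrite mulr0 mulr_ge0 ?(ltW (gauss_kernel_gt0 _ s20))// mulr_ge0.
rewrite mulr1.
have Wx : W ^+ 2 <= (x - m) ^+ 2.
  rewrite -(real_normK (num_real (x - m))) ler_sqr ?nnegrE// leNgt.
  apply/negP => xW; move/set_mem: xA; apply; rewrite /= in_itv/= -ler_distl.
  exact: ltW.
rewrite !gauss_kernelE.
have -> : 2 * expR (- (3 / 8 * (W / s) ^+ 2)) * (gauss_const R *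
    ((2 * s)^-1 * expR (- ((x - m) / (2 * s)) ^+ 2 / 2))) =
  gauss_const R * (s^-1 * (expR (- (3 / 8 * (W / s) ^+ 2)) *
    expR (- ((x - m) / (2 * s)) ^+ 2 / 2))) by field; rewrite gt_eqF.
rewrite ler_pM2l ?gauss_const_gt0// ler_pM2l ?invr_gt0// -expRD ler_expR.
rewrite -subr_ge0.
have -> : - (3 / 8 * (W / s) ^+ 2) + - ((x - m) / (2 * s)) ^+ 2 / 2 -
    - ((x - m) / s) ^+ 2 / 2 = 3 / 8 * ((x - m) ^+ 2 - W ^+ 2) / s ^+ 2.
  by field; rewrite gt_eqF.
by rewrite divr_ge0 ?sqr_ge0// mulr_ge0// subr_ge0.
Qed.

(** * Separation of locations and the union bound *)

Section separation.
Variables (R : realType) (n m : nat) (smin smax mu : R) (sigma : 'I_n -> R).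
Hypotheses (n0 : (0 < n)%N) (smin0 : 0 < smin)
  (sb : forall i, smin <= sigma i <= smax)
  (mS : (m <= #|[set i : 'I_n | (sigma i <= 1)%R]%SET|)%N).

Let s12 : smin <= smax.
Proof. by have /andP[/le_trans] := sb (Ordinal n0); apply. Qed.

Let GU : msupport (uniform_mixing sigma) `<=` `[smin, smax].
Proof. exact: uniform_mixing_support. Qed.

(** The two competing estimates of the difference between the masses of the
    mirror intervals: from below by the signals, from above by the affinity.  Both
    assume the true centre on the left, whence the reflection. *)
Lemma location_separation nu G (H : R) :
  msupport G `<=` `[smin, smax] -> nu != mu -> 0 <= H ->
  1 - H ^+ 2 / 2 <= affinity (average_density mu sigma) (mixture_density nu G) ->
  m%:R / n%:R * (signal_const R * (1 - expR (- `|nu - mu|))) <=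
  4 * H * Num.sqrt (2 * H / `|nu - mu|) + H ^+ 2.
Proof.
move=> GD numu H0 aff.
have dU a := density_mixture a smin0 s12 GU.
have uU a : sym_unimodal a (mixture_density a (uniform_mixing sigma)).
  exact: (sym_unimodal_mixture smin0 s12 GU).
have dG a := density_mixture a smin0 s12 GD.
have uG a : sym_unimodal a (mixture_density a G).
  exact: (sym_unimodal_mixture smin0 s12 GD).
have [lt|le] := ltrP mu nu.
  apply: le_trans (uniform_mixture_gap n0 smin0 sb mS lt) _.
  exact: sym_unimodal_gap lt (dU mu) (uU mu) (dG nu) (uG nu) H0 aff.
have lt : nu < mu by rewrite lt_neqAle numu.
apply: le_trans (uniform_mixture_gap n0 smin0 sb mS lt) _.
apply: (sym_unimodal_gap lt (dU nu) (uU nu) (dG mu) (uG mu) H0).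
(* the reflection about the midpoint exchanges the two centres *)
have refl a b (G' : probability (measurableTypeR R) R) x :
    msupport G' `<=` `[smin, smax] ->
    mixture_density b G' x = mixture_density a G' (a + b - x).
  move=> GD'; apply: (mixture_density_center smin0 GD').
  by rewrite -normrN; congr `|_|; ring.
have -> : mixture_density nu (uniform_mixing sigma) =
    (fun x => mixture_density mu (uniform_mixing sigma) (mu + nu - x)).
  by apply/funext => x; exact: refl.
have -> : mixture_density mu G = (fun x => mixture_density nu G (mu + nu - x)).
  by apply/funext => x; rewrite (addrC mu); exact: refl.
by rewrite affinity_reflect.
Qed.

End separation.

Lemma probability_bigsetU_le d (T : measurableType d) (R : realType)
    (P : probability T R) (I : finType) (A : I -> set T) (c : R) :
  (forall i, measurable (A i)) -> (forall i, P (A i) <= c%:E)%E ->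
  (P (\big[setU/set0]_(i : I) A i) <= (#|I|%:R * c)%:E)%E.
Proof.
move=> mA PA; rewrite cardE -big_enum.
elim: (enum I) => [|i r IH]; first by rewrite big_nil measure0 mul0r.
rewrite big_cons; have mU : measurable (\big[setU/set0]_(j <- r) A j).
  exact: bigsetU_measurable.
apply: le_trans (measureU2 P (mA i) mU) _.
have -> : (size (i :: r))%:R * c = c + (size r)%:R * c.
  by rewrite /= -natr1 mulrDl mul1r addrC.
by rewrite EFinD; exact: leeD (PA i) IH.
Qed.

Section deviation.
Context d (T : measurableType d) (R : realType) (P : probability T R).
Variables (n : nat) (smin smax mu : R) (sigma : 'I_n -> R)
  (X : 'I_n -> {RV P >-> R})
  (muhat : T -> R) (Ghat : T -> probability (measurableTypeR R) R).
Hypotheses (n0 : (0 < n)%N) (smin0 : 0 < smin) (s12 : smin <= smax)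
  (sb : forall i, smin <= sigma i <= smax)
  (indX : independent_RVs P X)
  (nX : forall i, has_normal_law P (X i) mu (sigma i))
  (EB : forall w, is_EB_maximizer smin smax (fun i => X i w) (muhat w) (Ghat w)).
Local Notation supp G := (msupport G `<=` `[smin, smax]%classic).
Local Notation p := (average_density mu sigma).

Variables (J K Z N : nat) (W step eta rho : R) (bad : R -> Prop).
Hypotheses (Z0 : (0 < Z)%N) (W0 : 0 <= W) (step0 : 0 < step) (eta0 : 0 <= eta)
  (smaxJ : smax < smin * 2 ^+ J) (WN : 2 * W / step < N.+1%:R)
  (etaE : (J%:R / Z%:R + (3 / 4) ^+ K) / smin + 2 * step / smin ^+ 2 <= eta)
  (rho0 : 0 <= rho)
  (bad_rho : forall nu G, supp G -> bad nu ->
    affinity p (mixture_density nu G) <= rho).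

Let cells := cell J K Z N.
Let code := mixture_cell smin smax J K Z N (mu - W) step.

(** A cell is represented by one of its bad mixtures, so that the affinity of the
    representative with the truth is at most [rho]; the midpoint of a cell would
    not do. *)
Let candidate (c : cells) (nuG : R * probability (measurableTypeR R) R) : Prop :=
  [/\ supp nuG.2, bad nuG.1, `|nuG.1 - mu| <= W & code nuG.1 nuG.2 = c].

Let rep (c : cells) : R * probability (measurableTypeR R) R :=
  xget (0, uniform_mixing sigma) [set nuG | candidate c nuG].

Let cell_event (c : cells) : set T :=
  if `[< exists nuG, candidate c nuG >] then
    ratio_event mu sigma X (mixture_density (rep c).1 (rep c).2) eta W
  else set0.

Let rep_candidate c : (exists nuG, candidate c nuG) -> candidate c (rep c).
Proof. by move=> ex; exact: (xgetPex (0, uniform_mixing sigma) ex). Qed.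

Let window_event (i : 'I_n) : set T := [set w | W < `|X i w - mu|].

Let bound := rho + (n%:R * eta * (2 * W) + n%:R^-1) / 2.

Let nr0 : 0 < n%:R :> R. Proof. by rewrite ltr0n. Qed.

Let bound0 : 0 <= bound.
Proof. by rewrite addr_ge0// divr_ge0// addr_ge0 ?invr_ge0 ?ler0n// !mulr_ge0. Qed.

Let measurable_cell_event c : measurable (cell_event c).
Proof.
rewrite /cell_event; case: asboolP => [/rep_candidate[GD _ _ _]|_] //.
have dq := density_mixture (rep c).1 smin0 s12 GD.
exact: (measurable_ratio_event mu X n0 smin0 sb W dq eta0).
Qed.

Let cell_event_prob c : (P (cell_event c) <= (bound ^+ n)%:E)%E.
Proof.
rewrite /cell_event; case: asboolP => [/rep_candidate[GD bd _ _]|_]; last first.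
  by rewrite measure0 lee_fin exprn_ge0.
have dq := density_mixture (rep c).1 smin0 s12 GD.
apply: le_trans (ratio_event_prob n0 smin0 sb indX nX dq eta0 W0 nr0) _.
rewrite lee_fin lerXn2r ?nnegrE//.
  rewrite /ratio_bound addr_ge0//; last first.
    by rewrite divr_ge0// addr_ge0 ?invr_ge0 ?ler0n// !mulr_ge0.
  by apply: Rintegral_ge0 => x _; rewrite mulr_ge0 ?sqrtr_ge0.
by rewrite /ratio_bound lerD2r bad_rho.
Qed.

Let measurable_window_event i : measurable (window_event i).
Proof.
have -> : window_event i = X i @^-1` (~` `[mu - W, mu + W]%classic).
  apply/seteqP; split => w; rewrite /window_event /= in_itv/= ltNge ler_distl;
    by [move/negP|move=> h; apply/negP].
by apply: measurable_funPTI; apply: measurableC; exact: measurable_itv.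
Qed.

Let window_event_prob i :
  (P (window_event i) <= (2 * expR (- (3 / 8 * (W / smax) ^+ 2)))%:E)%E.
Proof.
have /andP[s1 s2] := sb i; have s0 : 0 < sigma i by exact: lt_le_trans s1.
apply: le_trans (normal_tail s0 W0 (nX i)) _.
rewrite lee_fin ler_pM2l// ler_expR lerN2 ler_pM2l//.
rewrite lerXn2r ?nnegrE ?divr_ge0// ?(ltW s0) ?(le_trans (ltW s0))//.
by rewrite ler_wpM2l// lef_pV2 ?posrE// (lt_le_trans s0).
Qed.

(** If the maximizer is bad, so is the representative [q] of its cell, and
    [q + eta] is at least as likely as the truth; this has a small probability for
    each of the cells. *)
Lemma EB_deviation (delta : R) :
  n%:R * (2 * expR (- (3 / 8 * (W / smax) ^+ 2))) +
    (N.+1 * Z.+1 ^ (J * K))%:R * (rho + (n%:R * eta * (2 * W) + n%:R^-1) / 2) ^+ n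
    <= delta ->
  with_prob_at_least P (1 - delta) (fun w => ~ bad (muhat w)).
Proof.
move=> budget.
pose F := \big[setU/set0]_(i < n) window_event i `|`
  \big[setU/set0]_(c : cells) cell_event c.
have mF1 : measurable (\big[setU/set0]_(i < n) window_event i).
  exact: bigsetU_measurable.
have mF2 : measurable (\big[setU/set0]_(c : cells) cell_event c).
  exact: bigsetU_measurable.
have mF : measurable F by exact: measurableU.
have PF : (P F <= delta%:E)%E.
  apply: le_trans (measureU2 P mF1 mF2) _.
  apply: (@le_trans _ _ (n%:R * (2 * expR (- (3 / 8 * (W / smax) ^+ 2))) +
      (N.+1 * Z.+1 ^ (J * K))%:R * bound ^+ n)%:E); last by rewrite lee_fin.
  rewrite EFinD; apply: leeD.
    by have := probability_bigsetU_le measurable_window_event window_event_prob;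
      rewrite card_ord.
  by have := probability_bigsetU_le measurable_cell_event cell_event_prob;
    rewrite card_cell.
exists (~` F); split; first exact: measurableC.
  by rewrite probability_setC// EFinB leeB.
move=> w Fw bdw.
have XW i : `|X i w - mu| <= W.
  rewrite leNgt; apply/negP => h; apply: Fw; left.
  by rewrite (bigD1 i)//=; left.
have [GD _] := EB w.
have muW := EB_location_bound smin0 s12 n0 (EB w) XW.
pose c := code (muhat w) (Ghat w).
have ex : exists nuG, candidate c nuG by exists (muhat w, Ghat w).
have [GD' _ muW' ce] := rep_candidate ex.
apply: Fw; right; rewrite (bigD1 c)//=; left.
rewrite /cell_event asboolT// /ratio_event /=.
apply: (EB_ratio_event_mem smin0 s12 n0 sb (EB w) XW) => y.
have rng nu : `|nu - mu| <= W -> 0 <= (nu - (mu - W)) / step < N.+1%:R.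
  rewrite ler_norml => /andP[h1 h2]; apply/andP; split.
    by rewrite divr_ge0 ?(ltW step0)//; lra.
  apply: le_lt_trans WN; rewrite ler_pM2r ?invr_gt0//; lra.
apply: le_trans (mixture_cover smin0 smaxJ Z0 step0 GD GD' (rng _ muW)
  (rng _ muW') (esym ce) y) _.
by rewrite lerD2l.
Qed.

End deviation.

(** * The size of the cover *)

Section parameters.
Variables (R : realType) (n : nat) (smin smax delta : R).
Hypotheses (n0 : (0 < n)%N) (smin0 : 0 < smin) (s12 : smin <= smax)
  (delta01 : 0 < delta < 1).

Definition log_size : R := 1 + ln n%:R + ln (smax / smin) + ln delta^-1.
Local Notation L := log_size.
Local Notation E := (expR L).

Let nr1 : 1 <= n%:R :> R. Proof. by rewrite ler1n. Qed.
Let r1 : 1 <= smax / smin. Proof. by rewrite ler_pdivlMr ?mul1r. Qed.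
Let delta0 : 0 < delta. Proof. by have /andP[] := delta01. Qed.
Let deltaV1 : 1 <= delta^-1.
Proof. by have /andP[? ?] := delta01; rewrite invf_ge1// ltW. Qed.

Lemma log_size_ge1 : 1 <= L.
Proof. by rewrite /L -!addrA lerDl !addr_ge0 ?ln_ge0. Qed.

Lemma expR_log_size : E = expR 1 * n%:R * (smax / smin) * delta^-1.
Proof.
rewrite /L !expRD !lnK// posrE; first exact: lt_le_trans deltaV1.
  exact: lt_le_trans r1.
exact: lt_le_trans nr1.
Qed.

Let E2 : 2 <= E.
Proof.
have := expR_ge1Dx (1 : R).
by have := ler_expR 1 L; rewrite log_size_ge1 => /idP; lra.
Qed.

Let prod_ge1 (a b : R) : 1 <= a -> 1 <= b -> 1 <= a * b.
Proof. by move=> a1 b1; rewrite -[leLHS]mulr1 ler_pM. Qed.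

Let e1 : 1 <= expR (1 : R).
Proof. by rewrite -expR0 ler_expR. Qed.

Let nE : n%:R <= E.
Proof.
rewrite expR_log_size (_ : _ * _ = n%:R * (expR 1 * (smax / smin) * delta^-1)).
  by rewrite ler_peMr ?ler0n// prod_ge1// prod_ge1.
by ring.
Qed.

Let rE : smax / smin <= E.
Proof.
rewrite expR_log_size mulrAC [leRHS]mulrC ler_peMr//; first exact: le_trans r1.
by rewrite prod_ge1// prod_ge1.
Qed.

Let dE : E^-1 <= delta.
Proof.
rewrite -[leRHS]invrK lef_pV2 ?posrE ?expR_gt0 ?invr_gt0//.
rewrite expR_log_size [leRHS]mulrC ler_peMr ?invr_ge0 ?(ltW delta0)//.
by rewrite prod_ge1// prod_ge1.
Qed.

Let LE : L <= E.
Proof. by apply: le_trans (expR_ge1Dx _); rewrite lerDr. Qed.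

Let L1 := log_size_ge1.
Let E0 : 0 < E. Proof. exact: expR_gt0. Qed.
Let E1 : 1 <= E. Proof. by apply: le_trans E2; rewrite ler1n. Qed.

Let E2_4 : 4 <= E ^+ 2.
Proof.
by rewrite expr2 -[4%:R]/((2 * 2)%:R) natrM ler_pM.
Qed.

Let E3_8 : 8 <= E ^+ 3.
Proof.
by rewrite exprS -[8%:R]/((2 * 4)%:R) natrM ler_pM.
Qed.

Let EX k : E ^+ k = expR (k%:R * L).
Proof. by rewrite expRM_natl. Qed.

Let EXle (i j : nat) : (i <= j)%N -> E ^+ i <= E ^+ j.
Proof. by move=> ij; rewrite ler_weXn2l. Qed.

Definition ceil_nat (x : R) : nat := (Num.truncn x).+1.

Let ceil_lb x : x < (ceil_nat x)%:R.
Proof. exact: truncnS_gt. Qed.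

Let ceil_ub x : 0 <= x -> (ceil_nat x)%:R <= x + 1.
Proof. by move=> x0; rewrite /ceil_nat -natr1 lerD2r truncn_le. Qed.

Let ceil_succ k : (0 < k)%N -> (ceil_nat (E ^+ k)).+1%:R <= E ^+ k.+1.
Proof.
move=> k0; rewrite -natr1 exprS.
have h2 : 2 <= E ^+ k by apply: le_trans E2 _; rewrite -[leLHS]expr1; exact: EXle.
apply: (@le_trans _ _ (E ^+ k + 1 + 1)).
  by rewrite lerD2r ceil_ub// (le_trans _ h2).
apply: (@le_trans _ _ (2 * E ^+ k)); last by rewrite ler_wpM2r// (le_trans _ h2).
by move: (E ^+ k) h2 => u h2; lra.
Qed.

(** The numbers [J] of blocks and [K] of terms of the series are of order
    [log_size]; the other parameters are powers of [expR log_size].  Hence the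
    logarithm of the number of cells is of order [log_size ^+ 3], which the [n]-th
    power of [rho] outweighs. *)
Lemma cover_parameters : exists J K Z N : nat, exists W step eta : R,
  [/\ (0 < Z)%N, 0 <= W, 0 < step & 0 <= eta] /\
  [/\ smax < smin * 2 ^+ J, 2 * W / step < N.+1%:R,
    (J%:R / Z%:R + (3 / 4) ^+ K) / smin + 2 * step / smin ^+ 2 <= eta &
  forall rho, 0 <= rho <= 1 - 1750 * L ^+ 3 / n%:R ->
    n%:R * (2 * expR (- (3 / 8 * (W / smax) ^+ 2))) +
    (N.+1 * Z.+1 ^ (J * K))%:R * (rho + (n%:R * eta * (2 * W) + n%:R^-1) / 2) ^+ n
    <= delta].
Proof.
have n1 := nr1; have n_E := nE; have r_E := rE; have d_E := dE; have L_E := LE.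
have E_2 := E2; have l1 := L1; have e0 := E0; have e_1 := E1.
have s_0 := smin0; have r_1 := r1.
have L0 : 0 <= L by lra.
have budget_exponent (x y : R) : 1 <= y -> y <= x ->
    16 * x + 1722 * x + (1 - 1750 * x) <= - (2 * y) by lra.
have nr0 : 0 < n%:R :> R by lra.
have smax0 : 0 < smax by exact: lt_le_trans s12.
pose J := ceil_nat (2 * L); pose K := ceil_nat (40 * L).
pose Z := ceil_nat (E ^+ 13); pose N := ceil_nat (E ^+ 15).
pose W := 4 * L * smax; pose step := smin / E ^+ 10; pose eta := (E ^+ 8)^-1 / smin.
exists J, K, Z, N, W, step, eta.
have J3 : J%:R <= 3 * L by apply: le_trans (ceil_ub _) _; lra.
have K41 : K%:R <= 41 * L by apply: le_trans (ceil_ub _) _; lra.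
have Z0 : (0 : R) < Z%:R by rewrite ltr0n.
have W0 : 0 <= W by rewrite !mulr_ge0// ltW.
have eta0 : 0 <= eta by rewrite divr_ge0// ?(ltW smin0)// invr_ge0 exprn_ge0// ltW.
have EX0 k : 0 < E ^+ k by exact: exprn_gt0.
split; split => //.
- by rewrite divr_gt0.
- rewrite mulrC -ltr_pdivrMr//; apply: le_lt_trans r_E _.
  have h2 : expR (2^-1) <= 2 :> R.
    have := expR_ge1Dx (- 2^-1 : R); rewrite expRN => h.
    by rewrite -[leLHS]invrK -[leRHS]invrK lef_pV2 ?posrE ?invr_gt0 ?expR_gt0//; lra.
  apply: (@lt_le_trans _ _ (expR 2^-1 ^+ J)).
    by rewrite -expRM_natl ltr_expR; have := ceil_lb (2 * L); lra.
  by rewrite lerXn2r ?nnegrE ?expR_ge0.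
- have -> : 2 * W / step = 8 * L * (smax / smin) * E ^+ 10.
    by rewrite /W /step; field; rewrite !gt_eqF.
  apply: le_lt_trans (_ : _ <= E ^+ 15) _; last first.
    by apply: lt_trans (ceil_lb _) _; rewrite ltr_nat.
  have -> : E ^+ 15 = E ^+ 3 * E * E * E ^+ 10 by rewrite -!exprSr -exprD.
  have rr0 : 0 <= smax / smin by apply: le_trans r_1.
  rewrite ler_pM2r//; apply: ler_pM => //; first by rewrite mulr_ge0.
  by apply: ler_pM.
- rewrite /eta /step.
  have -> : (J%:R / Z%:R + (3 / 4) ^+ K) / smin + 2 * (smin / E ^+ 10) / smin ^+ 2 =
     (J%:R / Z%:R + (3 / 4) ^+ K + 2 / E ^+ 10) / smin.
    have := gt_eqF s_0; have := gt_eqF (EX0 10).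
    move: (J%:R / Z%:R) ((3 / 4) ^+ K) (E ^+ 10) => u v w w_neq0 s_neq0.
    by field; rewrite s_neq0 w_neq0.
  rewrite ler_pM2r ?invr_gt0//.
  have hJ : J%:R / Z%:R <= (E ^+ 10)^-1.
    rewrite ler_pdivrMr// ler_pdivlMl// mulrC.
    apply: le_trans (_ : _ <= E ^+ 13) _; last exact/ltW/ceil_lb.
    have -> : E ^+ 13 = E ^+ 2 * E * E ^+ 10 by rewrite -!exprSr -exprD.
    rewrite ler_pM2r//; apply: le_trans J3 _; rewrite ler_pM//.
    by apply: le_trans E2_4; rewrite ler_nat.
  have hK : (3 / 4) ^+ K <= (E ^+ 10)^-1.
    have h34 : 3 / 4 <= expR (- 4^-1 : R) by have := expR_ge1Dx (- 4^-1 : R); lra.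
    apply: (@le_trans _ _ (expR (- 4^-1) ^+ K)).
      by rewrite lerXn2r ?nnegrE ?expR_ge0// divr_ge0.
    rewrite -expRM_natl EX -expRN ler_expR.
    by have := ceil_lb (40 * L); rewrite -/K; lra.
  apply: (@le_trans _ _ (4 / E ^+ 10)).
    have -> : 4 / E ^+ 10 = (E ^+ 10)^-1 + (E ^+ 10)^-1 + 2 / E ^+ 10.
      by move: (_^-1) => u; ring.
    by rewrite lerD2r lerD.
  rewrite ler_pdivrMr// -[E ^+ 10]/(E ^+ (8 + 2)) exprD mulKf ?gt_eqF//.
move=> rho /andP[rho0 rho1].
have rr0 : 0 <= smax / smin by apply: le_trans r_1.
have L3 : L <= L ^+ 3 by rewrite -[leLHS]expr1 ler_weXn2l.
have L2 : L <= L ^+ 2 by rewrite -[leLHS]expr1 ler_weXn2l.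
have tail : n%:R * (2 * expR (- (3 / 8 * (W / smax) ^+ 2))) <= (E ^+ 2)^-1.
  have -> : W / smax = 4 * L by rewrite /W mulfK ?gt_eqF.
  have h6 : expR (- (3 / 8 * (4 * L) ^+ 2)) <= (E ^+ 6)^-1.
    by rewrite EX -expRN ler_expR exprMn; lra.
  apply: (@le_trans _ _ (E * (E * (E ^+ 6)^-1))).
    by rewrite !ler_pM ?ler0n ?mulr_ge0 ?expR_ge0.
  have -> : E * (E * (E ^+ 6)^-1) = (E ^+ 4)^-1 by field; rewrite gt_eqF.
  by rewrite lef_pV2 ?posrE// EXle.
have cN : N.+1%:R <= expR (16 * L ^+ 3) :> R.
  apply: (@le_trans _ _ (E ^+ 16)); last by rewrite EX ler_expR; lra.
  exact: ceil_succ.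
have cZ : Z.+1%:R <= E ^+ 14 :> R.
  exact: ceil_succ.
have cZJK : Z.+1%:R ^+ (J * K) <= expR (1722 * L ^+ 3) :> R.
  apply: (@le_trans _ _ ((E ^+ 14) ^+ (J * K))).
    by rewrite lerXn2r ?nnegrE ?(ltW (EX0 _)).
  rewrite -exprM EX ler_expR natrM natrM.
  have JK : J%:R * K%:R <= (3 * L) * (41 * L) by rewrite ler_pM.
  have -> : 1722 * L ^+ 3 = 14 * (3 * L * (41 * L)) * L by ring.
  by rewrite ler_wpM2r// ler_wpM2l.
have small : n%:R * eta * (2 * W) <= n%:R^-1.
  have -> : n%:R * eta * (2 * W) = 8 * n%:R * L * (smax / smin) * (E ^+ 8)^-1.
    rewrite /eta /W; have := gt_eqF s_0; move: (n%:R) (E ^+ 8)^-1 => u v s_neq0.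
    by field; rewrite s_neq0.
  rewrite ler_pdivrMr// ler_pdivlMl//.
  apply: (@le_trans _ _ (E * (E ^+ 3 * E * E * E))).
    apply: ler_pM => //; first by rewrite mulr_ge0// !mulr_ge0.
    apply: ler_pM => //; first by rewrite !mulr_ge0.
    by apply: ler_pM => //; apply: ler_pM.
  have -> : E * (E ^+ 3 * E * E * E) = E ^+ 7 by ring.
  exact: EXle.
set b := rho + _.
have b0 : 0 <= b.
  by rewrite addr_ge0// divr_ge0// addr_ge0 ?invr_ge0// mulr_ge0//; exact: mulr_ge0.
have bn : b ^+ n <= expR (1 - 1750 * L ^+ 3).
  have -> : 1 - 1750 * L ^+ 3 = n%:R * ((1 - 1750 * L ^+ 3) / n%:R).
    by rewrite [RHS]mulrC divfK// gt_eqF.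
  rewrite expRM_natl lerXn2r ?nnegrE ?expR_ge0//.
  apply: le_trans (expR_ge1Dx _); rewrite /b mulrBl mul1r.
  have half : (n%:R * eta * (2 * W) + n%:R^-1) / 2 <= n%:R^-1.
    by rewrite ler_pdivrMr// mulr_natr mulr2n lerD2r.
  by apply: le_trans (lerD rho1 half) _; rewrite -addrA [- _ + _]addrC.
(* [14 * 3 * 41 = 1722] from the moments and [16] from the locations *)
have cells_le : (N.+1 * Z.+1 ^ (J * K))%:R * b ^+ n <= (E ^+ 2)^-1.
  apply: (@le_trans _ _ (expR (16 * L ^+ 3) * expR (1722 * L ^+ 3) *
      expR (1 - 1750 * L ^+ 3))).
    apply: ler_pM => //; first exact: exprn_ge0.
    by rewrite natrM natrX; apply: ler_pM => //; exact: exprn_ge0.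
  by rewrite -!expRD EX -expRN ler_expR budget_exponent.
apply: le_trans (lerD tail cells_le) _; apply: le_trans _ d_E.
rewrite -mulr2n -mulr_natr ler_pdivrMl//.
by rewrite expr2 mulfK ?gt_eqF.
Qed.

End parameters.

(** * The rate *)

Section rate.
Variables (R : realType) (A kappa : R).
Hypothesis kappa0 : 0 < kappa.

Definition rate_const : R := 512 ^+ 2 * A ^+ 3 / kappa ^+ 4.

(** The term [H ^+ 2] is dominated by the one with the square root when [D <= 1],
    because [H <= 1], and by the left-hand side when [1 <= D], because of the lower
    bound on [m].  Squaring then removes the square root, and squaring once more
    leaves a power of [H ^+ 2]. *)
Lemma rate_of_separation (n m L H D : R) :
  0 < m -> m <= n -> 1 <= L -> 0 <= H -> H ^+ 2 = A * L ^+ 3 / n ->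
  A * L ^+ 3 <= n -> 4 * (A * L ^+ 3) <= kappa * m -> 0 < D ->
  m / n * (kappa * (1 - expR (- D))) <= 4 * H * Num.sqrt (2 * H / D) + H ^+ 2 ->
  (D <= 1 -> D ^+ 6 <= rate_const * L ^+ 9 * (n / m ^+ 4)) /\
  (1 <= D -> D ^+ 2 <= rate_const * L ^+ 9 * (n / m ^+ 4)).
Proof.
move=> m0 mn L1 H0 HE An Am D0 sep.
have k0 := kappa0.
have n0 : 0 < n by exact: lt_le_trans mn.
set a := m / n * kappa.
have a0 : 0 < a by rewrite mulr_gt0// divr_gt0.
have aE : a = m / n * kappa by [].
clearbody a; rewrite mulrA -aE in sep.
set s := Num.sqrt _ in sep.
have s0 : 0 <= s by exact: sqrtr_ge0.
have s2 : s ^+ 2 = 2 * H / D.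
  by rewrite sqr_sqrtr// divr_ge0 ?(ltW D0)// mulr_ge0.
clearbody s.
have H1 : H <= 1.
  by rewrite -(@ler_pXn2r _ 2) ?nnegrE// expr1n HE ler_pdivrMr ?mul1r.
have Ha : H ^+ 2 <= a / 4.
  rewrite HE ler_pdivlMr// aE; have : 4 * (A * L ^+ 3) / n <= kappa * m / n.
    by rewrite ler_pM2r ?invr_gt0.
  by rewrite -!mulrA [_ / n]mulrC => h; lra.
have scale : H ^+ 6 = (A * L ^+ 3) ^+ 3 / n ^+ 3.
  by rewrite -[6%N]/((2 * 3)%N) exprM HE expr_div_n.
(* an abstract [B], because the numeral would be unfolded in unary *)
have [B BE [B0 B200]] : exists2 B : R, 512 = B & 0 <= B /\ 200 <= B.
  by exists 512; rewrite ?ler0n ?ler_nat.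
rewrite /rate_const BE.
have finish (t : R) : 0 <= t -> t * a ^+ 2 <= B * H ^+ 3 ->
    t ^+ 2 <= B ^+ 2 * A ^+ 3 / kappa ^+ 4 * L ^+ 9 * (n / m ^+ 4).
  move=> t0 ht.
  have : (t * a ^+ 2) ^+ 2 <= (B * H ^+ 3) ^+ 2.
    by rewrite lerXn2r ?nnegrE ?mulr_ge0 ?exprn_ge0 ?(ltW a0).
  rewrite exprMn -exprM exprMn -exprM scale -ler_pdivlMr ?exprn_gt0// => h.
  apply: le_trans h _; rewrite le_eqVlt; apply/orP; left; apply/eqP.
  by rewrite aE; field; rewrite !gt_eqF.
split=> D1.
  have e : D / 2 <= 1 - expR (- D).
    have := expR_ge1Dx D; rewrite expRN => h.
    have : (expR D)^-1 <= (1 + D)^-1 by rewrite lef_pV2 ?posrE ?expR_gt0//; lra.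
    have : (1 + D)^-1 <= 1 - D / 2.
      
        rewrite -[leLHS]mul1r ler_pdivrMr; last by lra.
        have : D * D <= D * 1 by rewrite ler_wpM2l// ltW.
        by lra.
    by lra.
  have Hs : H <= s.
    rewrite -(@ler_pXn2r _ 2) ?nnegrE// s2 ler_pdivlMr// expr2.
    have : H * D <= 1 by rewrite -[leRHS]mulr1 ler_pM// ltW.
    by move=> h; rewrite -subr_ge0 (_ : _ - _ = H * (2 - H * D)) ?mulr_ge0//; [lra|ring].
  have h : a * D <= 10 * H * s.
    have : a * (D / 2) <= a * (1 - expR (- D)) by rewrite ler_wpM2l// ltW.
    have : H ^+ 2 <= H * s by rewrite expr2 ler_wpM2l.
    by lra.
  rewrite -[6%N]/((3 * 2)%N) exprM; apply: finish; first exact/exprn_ge0/ltW.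
  have := lerXn2r 2 (_ : a * D \is Num.nneg) (_ : 10 * H * s \is Num.nneg) h.
  rewrite !nnegrE !mulr_ge0 ?(ltW a0) ?(ltW D0)// => /(_ isT isT).
  rewrite [leRHS]exprMn s2 mulrA ler_pdivlMr// => h2.
  have -> : D ^+ 3 * a ^+ 2 = (a * D) ^+ 2 * D by ring.
  apply: le_trans h2 _; apply: (@le_trans _ _ (200 * H ^+ 3)); last first.
    by rewrite ler_wpM2r ?exprn_ge0.
  by rewrite le_eqVlt; apply/orP; left; apply/eqP; ring.
have e : 2^-1 <= 1 - expR (- D).
  have := expR_ge1Dx D; rewrite expRN => h.
  have : (expR D)^-1 <= 2^-1 by rewrite lef_pV2 ?posrE ?expR_gt0//; lra.
  by lra.
have h : a <= 16 * H * s.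
  have : a * 2^-1 <= a * (1 - expR (- D)) by rewrite ler_wpM2l// ltW.
  by lra.
apply: finish; first exact: ltW.
have := lerXn2r 2 (_ : a \is Num.nneg) (_ : 16 * H * s \is Num.nneg) h.
rewrite !nnegrE !mulr_ge0 ?(ltW a0)// => /(_ isT isT).
rewrite [leRHS]exprMn s2 mulrA ler_pdivlMr// => h2.
rewrite mulrC; apply: le_trans h2 _.
by rewrite -BE le_eqVlt; apply/orP; left; apply/eqP; ring.
Qed.

End rate.

Section error_bound.
Context d (T : measurableType d) (R : realType) (P : probability T R).
Variables (n m : nat) (smin smax mu delta A : R) (sigma : 'I_n -> R)
  (X : 'I_n -> {RV P >-> R})
  (muhat : T -> R) (Ghat : T -> probability (measurableTypeR R) R).
Local Notation L := (log_size n smin smax delta).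
Local Notation kappa := (signal_const R).

(** A location at distance [D > b] violates one of the inequalities of
    [rate_of_separation]; the value of [A] makes [1 - H ^+ 2 / 2] the largest
    affinity in [cover_parameters]. *)
Lemma EB_error_bound (b : R) :
  0 < smin -> smin <= smax -> (forall i, smin <= sigma i <= smax) ->
  0 < delta < 1 ->
  (m <= #|[set i : 'I_n | (sigma i <= 1)%R]%SET|)%N ->
  independent_RVs P X ->
  (forall i, has_normal_law P (X i) mu (sigma i)) ->
  (forall w, is_EB_maximizer smin smax (fun i => X i w) (muhat w) (Ghat w)) ->
  A = 3500 -> (0 < m)%N -> (m <= n)%N ->
  A * L ^+ 3 <= n%:R -> 4 * (A * L ^+ 3) <= kappa * m%:R -> 0 <= b ->
  (forall D : R, 0 < D ->
    (D <= 1 -> D ^+ 6 <= rate_const A kappa * L ^+ 9 * (n%:R / m%:R ^+ 4)) ->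
    (1 <= D -> D ^+ 2 <= rate_const A kappa * L ^+ 9 * (n%:R / m%:R ^+ 4)) ->
    D <= b) ->
  with_prob_at_least P (1 - delta) (fun w => `|muhat w - mu| <= b).
Proof.
move=> smin0 s12 sb delta01 mS indX nX EB AE m0 mn An Am b0 Db.
have n0 : (0 < n)%N by exact: leq_trans mn.
have nr0 : 0 < n%:R :> R by rewrite ltr0n.
have L1 : 1 <= L by exact: log_size_ge1.
have A0 : 0 <= A by rewrite AE ler0n.
have AL0 : 0 <= A * L ^+ 3 / n%:R.
  by rewrite divr_ge0// mulr_ge0// exprn_ge0// (le_trans _ L1).
have AL1 : A * L ^+ 3 / n%:R <= 1 by rewrite ler_pdivrMr ?mul1r.
pose H := Num.sqrt (A * L ^+ 3 / n%:R).
have H0 : 0 <= H by exact: sqrtr_ge0.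
have HE : H ^+ 2 = A * L ^+ 3 / n%:R by rewrite sqr_sqrtr.
have rho0 : 0 <= 1 - H ^+ 2 / 2 by rewrite HE; lra.
have rho1 : 0 <= 1 - H ^+ 2 / 2 <= 1 - 1750 * L ^+ 3 / n%:R.
  rewrite rho0/= HE lerD2l lerN2 !mulrA le_eqVlt; apply/orP; left; apply/eqP.
  have -> : A = 2 * 1750 by rewrite AE -natrM.
  by move: (1750) => u; field; rewrite gt_eqF.
have [J [K [Z [N [W [step [eta [[Z0 W0 st0 et0] [sJ WN etaE budget]]]]]]]]] :=
  cover_parameters n0 smin0 s12 delta01.
have bad_rho nu G : msupport G `<=` `[smin, smax] -> b < `|nu - mu| ->
    affinity (average_density mu sigma) (mixture_density nu G) <= 1 - H ^+ 2 / 2.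
  move=> GD bD; rewrite leNgt; apply/negP => /ltW aff.
  have D0 : 0 < `|nu - mu| by exact: le_lt_trans bD.
  have numu : nu != mu by rewrite -subr_eq0 -normr_gt0.
  have sep := location_separation n0 smin0 sb mS GD numu H0 aff.
  have mr0 : 0 < m%:R :> R by rewrite ltr0n.
  have mnr : m%:R <= n%:R :> R by rewrite ler_nat.
  have [small large] := rate_of_separation (signal_const_gt0 R) mr0 mnr L1 H0
    HE An Am D0 sep.
  by have := lt_le_trans bD (Db _ D0 small large); rewrite ltxx.
have [E [mE PE Eb]] := EB_deviation n0 smin0 s12 sb indX nX EB
  (bad := fun nu => b < `|nu - mu|) Z0 W0 st0 et0 sJ WN etaE rho0 bad_rho
  (budget _ rho1).
by exists E; split=> // w /Eb /negP; rewrite -leNgt.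
Qed.

End error_bound.

Lemma powR_inv_exp (R : realType) (x : R) (k : nat) :
  0 <= x -> (0 < k)%N -> (x `^ k%:R^-1) ^+ k = x.
Proof.
move=> x0 k0; rewrite -powR_mulrn ?powR_ge0// -powRrM mulVf ?powRr1//.
by rewrite pnatr_eq0 -lt0n.
Qed.

Section rate_root.
Variables (R : realType) (c C L x D : R).
Hypotheses (c0 : 0 <= c) (cC : c <= C) (C1 : 1 <= C) (L1 : 1 <= L) (D0 : 0 < D).

Let CL1 : 1 <= C * L ^+ 5.
Proof. by rewrite -[leLHS]mulr1 ler_pM// exprn_ege1. Qed.

Let CL0 : 0 <= C * L ^+ 5. Proof. exact: le_trans CL1. Qed.

Let absorb : c * L ^+ 9 <= (C * L ^+ 5) ^+ 2.
Proof.
rewrite exprMn -exprM ler_pM ?exprn_ge0 ?(le_trans _ L1)//.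
  by apply: le_trans cC _; rewrite -[leLHS]expr1 ler_weXn2l.
exact: ler_weXn2l.
Qed.

(** When [1 <= x] the bound exceeds [1], and only large [D] matter. *)
Lemma rate_sqrt :
  1 <= x -> (1 <= D -> D ^+ 2 <= c * L ^+ 9 * x) -> D <= C * L ^+ 5 * x `^ 2^-1.
Proof.
move=> x1 large; have x0 : 0 <= x by exact: le_trans x1.
rewrite -(@ler_pXn2r _ 2) ?nnegrE ?(ltW D0) ?(mulr_ge0 CL0) ?powR_ge0//.
rewrite exprMn powR_inv_exp//; have [D1|/ltW/large h] := lerP D 1.
  apply: (@le_trans _ _ 1); first by rewrite exprn_ile1// ltW.
  by rewrite -[leLHS]mulr1 ler_pM ?exprn_ege1.
by apply: le_trans h _; rewrite ler_wpM2r.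
Qed.

(** When [x <= 1], a large [D] satisfies [D ^+ 6 = (D ^+ 2) ^+ 3], at most a
    multiple of [x ^+ 3 <= x]. *)
Lemma rate_sixth_root :
  0 <= x -> x <= 1 -> (D <= 1 -> D ^+ 6 <= c * L ^+ 9 * x) ->
  (1 <= D -> D ^+ 2 <= c * L ^+ 9 * x) -> D <= C * L ^+ 5 * x `^ 6^-1.
Proof.
move=> x0 x1 small large.
rewrite -(@ler_pXn2r _ 6) ?nnegrE ?(ltW D0) ?(mulr_ge0 CL0) ?powR_ge0//.
rewrite exprMn powR_inv_exp//; have [/small h|/ltW/large h] := lerP D 1.
  apply: le_trans h _; rewrite ler_wpM2r//; apply: le_trans absorb _.
  exact: ler_weXn2l.
apply: (@le_trans _ _ ((c * L ^+ 9 * x) ^+ 3)).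
  rewrite -[6%N]/((2 * 3)%N) exprM lerXn2r ?nnegrE ?exprn_ge0 ?(ltW D0)//.
  by rewrite (le_trans _ h)// exprn_ge0// ltW.
rewrite exprMn -[6%N]/((2 * 3)%N) exprM.
have cL0 : 0 <= c * L ^+ 9 by rewrite mulr_ge0// exprn_ge0// (le_trans _ L1).
apply: ler_pM; rewrite ?exprn_ge0//.
  by rewrite lerXn2r ?nnegrE ?exprn_ge0.
by rewrite -[leRHS]expr1 ler_wiXn2l.
Qed.

End rate_root.


Theorem theorem1p3 (R : realType) :
  exists (C0 C1 C2 : R) (k0 k1 k2 : nat),
    [/\ 0 < C0, 0 < C1, 0 < C2 &
    forall (n m : nat) (smin smax mu delta : R) (sigma : 'I_n -> R)
      (d : measure_display) (T : measurableType d) (P : probability T R)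
      (X : 'I_n -> {RV P >-> R})
      (muhat : T -> R) (Ghat : T -> probability (measurableTypeR R) R),
    0 < smin -> smin <= smax ->
    (forall i, smin <= sigma i <= smax) ->
    0 < delta < 1 ->
    (m <= #|[set i : 'I_n | (sigma i <= 1)%R]%SET|)%N ->
    independent_RVs P X ->
    (forall i, has_normal_law P (X i) mu (sigma i)) ->
    (forall w, is_EB_maximizer smin smax (fun i => X i w) (muhat w) (Ghat w)) ->
    polylog C0 k0 n (smax / smin) delta < m%:R ->
    ((m%:R : R) <= n%:R `^ 4^-1 ->
       with_prob_at_least P (1 - delta) (fun w =>
         `|muhat w - mu| <=
           polylog C1 k1 n (smax / smin) delta
           * (n%:R / m%:R ^+ 4) `^ 2^-1))
    /\
    ((n%:R : R) `^ 4^-1 <= m%:R -> (m <= n)%N ->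
       with_prob_at_least P (1 - delta) (fun w =>
         `|muhat w - mu| <=
           polylog C2 k2 n (smax / smin) delta
           * (n%:R / m%:R ^+ 4) `^ 6^-1))].


Proof.
pose kappa := signal_const R; have kappa0 : 0 < kappa := signal_const_gt0 R.
have [A AE] : exists A : R, A = 3500 by exists 3500.
have A0 : 0 < A by rewrite AE ltr0n.
have c0 : 0 <= rate_const A kappa.
  by rewrite /rate_const !mulr_ge0 ?invr_ge0 ?exprn_ge0 ?ler0n// ltW.
have Ak0 : 0 <= 4 * A / kappa by rewrite divr_ge0 ?(ltW kappa0)// mulr_ge0// ltW.
pose C := rate_const A kappa + 1.
have C1 : 1 <= C by rewrite lerDr.
have cC : rate_const A kappa <= C by rewrite lerDl.
have C0 : 0 < C by exact: lt_le_trans C1.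
exists (4 * A / kappa + A), C, C, 3%N, 5%N, 5%N; split=> //.
  exact: ltr_wpDl.
(* [A * L ^+ 3 <= m <= n] gives [H <= 1], and [4 * A / kappa] the other
   hypothesis of [EB_error_bound] *)
move=> n m smin smax mu delta sigma d T P X muhat Ghat smin0 s12 sb delta01 mS
  indX nX EB; rewrite /polylog -/(log_size n smin smax delta).
move=> mL.
have mn : (m <= n)%N by apply: leq_trans mS _; rewrite -[leqRHS]card_ord max_card.
have [n0|n0] := posnP n.
  (* there is no signal, although the polylogarithmic factor is positive *)
  have m0 : m%:R = 0 :> R by move: mn; rewrite n0 leqn0 => /eqP ->.
  have r1 : 1 <= smax / smin by rewrite ler_pdivlMr ?mul1r.
  have d1 : 1 <= delta^-1 by have /andP[? /ltW ?] := delta01; rewrite invf_ge1.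
  move: mL; rewrite ltNge m0 mulr_ge0//.
    by rewrite addr_ge0 ?(ltW A0).
  by rewrite exprn_ge0// /log_size n0 ln0// !addr_ge0 ?ln_ge0.
have L1 : 1 <= log_size n smin smax delta by exact: log_size_ge1.
move: mL L1; set L := log_size n smin smax delta => mL L1.
have L3 : 0 <= L ^+ 3 by rewrite exprn_ge0// (le_trans _ L1).
have mnr : m%:R <= n%:R :> R by rewrite ler_nat.
have mr0 : 0 < m%:R :> R.
  by apply: le_lt_trans mL; rewrite mulr_ge0// addr_ge0 ?(ltW A0).
have Am : A * L ^+ 3 <= m%:R.
  by apply: le_trans (ltW mL); rewrite ler_wpM2r// lerDr.
have Akm : 4 * (A * L ^+ 3) <= kappa * m%:R.
  rewrite -ler_pdivrMl// mulrC; apply: le_trans (ltW mL).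
  rewrite mulrA mulrAC ler_wpM2r// lerDl; exact: ltW.
have m0 : (0 < m)%N by rewrite -(ltr0n R).
have b0 e : 0 <= C * L ^+ 5 * (n%:R / m%:R ^+ 4) `^ e.
  by rewrite mulr_ge0 ?powR_ge0// mulr_ge0 ?(ltW C0)// exprn_ge0// (le_trans _ L1).
have key b := EB_error_bound (b := b) smin0 s12 sb delta01 mS indX nX EB AE m0 mn
  (le_trans Am mnr) Akm.
have root : (n%:R `^ 4^-1) ^+ 4 = n%:R :> R by exact: powR_inv_exp.
split=> [small|large _]; apply: key => // D D0 D_le1 D_ge1.
  apply: (rate_sqrt c0 cC C1 L1 D0 _ D_ge1).
  rewrite ler_pdivlMr ?exprn_gt0// mul1r -root.
  by rewrite lerXn2r ?nnegrE ?powR_ge0.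
apply: (rate_sixth_root c0 cC C1 L1 D0 _ _ D_le1 D_ge1).
  by rewrite divr_ge0// exprn_ge0.
rewrite ler_pdivrMr ?exprn_gt0// mul1r -root.
by rewrite lerXn2r ?nnegrE ?powR_ge0.
Qed.
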